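(* Let $(M,\bar g,u)$ be a non-Einstein, complete, expanding gradient Ricci soliton of cohomogeneity one with a special orbit, with soliton constant $\epsilon>0$ and $\dim M=n+1$. Then there exists $t_1>0$ such that on $(t_1,\infty)$ we have $$\mathrm{tr}\,L<\sqrt{\frac{n\epsilon}{2}}.$$
   Context: An expanding gradient Ricci soliton is $(M,\bar g,u)$, with $\bar g$ a smooth Riemannian metric and $u$ a smooth function, satisfying $\mathrm{Ric}(\bar g)+\mathrm{Hess}(u)+\frac{\epsilon}{2}\bar g=0$ for a constant $\epsilon>0$. It is complete if $\bar g$ is complete, and non-Einstein if $\bar g$ is not an Einstein metric. ''Cohomogeneity one with a special orbit'' refers to the following setting. $M$ is noncompact of dimension $n+1$. There is a compact submanifold of $M$ (the special orbit) such that, with $t\in[0,\infty)$ the distance from it, the complement is identified with $(0,\infty)\times P$ with $P$ a compact $n$-manifold, and $\bar g=dt^2+g_t$ there, where $g_t$ is a metric on the hypersurface $P_t=\{t\}\times P$. As $t\to0$ the hypersurfaces collapse smoothly onto the special orbit, which is placed at $t=0$, with collapsing spheres of dimension $k\ge1$ (so the special orbit has codimension $k+1$). The potential $u$ is a function of $t$ only. The scalar curvature $S$ of $g_t$ and the mean curvature $\mathrm{tr}\,L$ of $P_t$ with respect to $\partial/\partial t$ are constant on each $P_t$; here $L=L_t$ is the shape operator, defined by $\dot g_t=2g_tL_t$. This holds for instance if a compact Lie group acts isometrically with principal orbits $P_t$ and preserves $u$. The potential is normalized by $u(0)=0$. A dot denotes $d/dt$. *)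

(* Defs.v *)
From HB Require Import structures.
From mathcomp Require Import all_boot all_order all_algebra.
From mathcomp Require Import all_classical all_reals all_analysis.
Set Implicit Arguments.
Unset Strict Implicit.
Unset Printing Implicit Defensive.
Import Order.TTheory GRing.Theory Num.Theory numFieldNormedType.Exports.
Local Open Scope classical_set_scope.
Local Open Scope ring_scope.

Section Coordinates.
Variables (R : realType) (m : nat).
Implicit Types (f : 'rV[R]_m -> R) (G : 'rV[R]_m -> 'M[R]_m).

Definition partial (i : 'I_m) f : 'rV[R]_m -> R :=
  fun x => 'D_(delta_mx 0 i) f x.

(* C^infinity on the open set U; f may be arbitrary outside U. *)
Definition smooth_on (U : set 'rV[R]_m) f : Prop :=
  forall (s : seq 'I_m) x, U x -> differentiable (foldr partial f s) x.

(* Gamma^l_{ij} of the metric with components G *)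
Definition christoffel G (l i j : 'I_m) : 'rV[R]_m -> R := fun x =>
  2^-1 * \sum_(p < m) invmx (G x) l p *
    (partial i (fun y => G y j p) x + partial j (fun y => G y i p) x
     - partial p (fun y => G y i j) x).

(* Sign convention: round spheres have positive Ricci curvature. *)
Definition ricci G (i j : 'I_m) : 'rV[R]_m -> R := fun x =>
  \sum_(l < m)
    (partial l (christoffel G l i j) x - partial j (christoffel G l i l) x
     + \sum_(p < m) (christoffel G l l p x * christoffel G p i j x
                     - christoffel G l j p x * christoffel G p i l x)).

Definition scalar_curvature G : 'rV[R]_m -> R := fun x =>
  \sum_(i < m) \sum_(j < m) invmx (G x) i j * ricci G i j x.

Definition hessian G f (i j : 'I_m) : 'rV[R]_m -> R := fun x =>
  partial i (partial j f) x
  - \sum_(l < m) christoffel G l i j x * partial l f x.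

End Coordinates.

Section Manifolds.
Variable R : realType.

(* A chart is a pair of mutually inverse maps between [cdom] and its image;
   both are total functions, with irrelevant values elsewhere. *)
Record chart (M : Type) (m : nat) := Chart {
  cdom : set M;
  cmap : M -> 'rV[R]_m;
  cinv : 'rV[R]_m -> M }.

Definition crange M m (c : chart M m) : set 'rV[R]_m := cmap c @` cdom c.

Definition is_chart (M : topologicalType) m (c : chart M m) : Prop :=
  [/\ open (cdom c),
      open (crange c),
      forall x, cdom c x -> cinv c (cmap c x) = x,
      forall x, cdom c x -> {for x, continuous (cmap c)} &
      forall y, crange c y -> {for y, continuous (cinv c)}].

Definition compatible M m (c c' : chart M m) : Prop :=
  forall j : 'I_m, smooth_on (cmap c @` (cdom c `&` cdom c'))
    (fun y => cmap c' (cinv c y) 0 j).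

(* A smooth structure is given by its maximal atlas A. *)
Record smooth_manifold (M : topologicalType) m (A : set (chart M m)) : Prop := {
  manifold_hausdorff : hausdorff_space M;
  manifold_second_countable : @second_countable M;
  atlas_chart : forall c, A c -> is_chart c;
  atlas_cover : forall x, exists2 c, A c & cdom c x;
  atlas_compatible : forall c c', A c -> A c' -> compatible c c';
  atlas_maximal : forall c, is_chart c ->
    (forall c', A c' -> compatible c c' /\ compatible c' c) -> A c }.

Section Metric.
Variables (M : topologicalType) (m : nat) (A : set (chart M m)).
Implicit Types (c : chart M m) (u : M -> R) (gamma : R -> M).

Definition smooth_function u : Prop :=
  forall c, A c -> smooth_on (crange c) (u \o cinv c).

(* The metric is the family [G c] of its component matrices in the charts.
   The library's Jacobian matrix acts on row vectors from the right, so its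
   (i, j) entry is d(phi_j)/dx_i. *)
Record riemannian_metric (G : chart M m -> 'rV[R]_m -> 'M[R]_m) : Prop := {
  metric_smooth : forall c, A c -> forall i j : 'I_m,
    smooth_on (crange c) (fun x => G c x i j);
  metric_sym : forall c, A c -> forall x, crange c x -> (G c x)^T = G c x;
  metric_pos : forall c, A c -> forall x, crange c x ->
    forall v : 'rV[R]_m, v != 0 -> 0 < (v *m G c x *m v^T) 0 0;
  metric_change : forall c c', A c -> A c' ->
    forall p, cdom c p -> cdom c' p ->
    let J := jacobian (cmap c' \o cinv c) (cmap c p) in
    G c (cmap c p) = J *m G c' (cmap c' p) *m J^T }.

Variable G : chart M m -> 'rV[R]_m -> 'M[R]_m.

Definition gradient_soliton (eps : R) u : Prop :=
  forall c, A c -> forall x, crange c x -> forall i j : 'I_m,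
    ricci (G c) i j x + hessian (G c) (u \o cinv c) i j x
    + eps / 2 * G c x i j = 0.

Definition einstein : Prop :=
  exists lam : R, forall c, A c -> forall x, crange c x ->
    forall i j : 'I_m, ricci (G c) i j x = lam * G c x i j.

Definition coord c gamma (i : 'I_m) : R -> R := fun s => cmap c (gamma s) 0 i.

Definition velocity c gamma (s : R) : 'rV[R]_m :=
  \row_(i < m) derive1 (coord c gamma i) s.

Definition geodesic gamma : Prop :=
  forall s, {for s, continuous gamma} /\
    forall c, A c -> cdom c (gamma s) -> forall l : 'I_m,
      [/\ \forall r \near s, derivable (coord c gamma l) r 1,
          derivable (derive1 (coord c gamma l)) s 1 &
          derive1 (derive1 (coord c gamma l)) s
          + \sum_(i < m) \sum_(j < m)
              christoffel (G c) l i j (cmap c (gamma s))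
              * velocity c gamma s 0 i * velocity c gamma s 0 j = 0].

(* Geodesic completeness: all geodesics are defined on the whole real line. *)
Definition complete_metric : Prop :=
  forall c p (v : 'rV[R]_m), A c -> cdom c p ->
    exists gamma, [/\ geodesic gamma, gamma 0 = p & velocity c gamma 0 = v].

Definition C1_curve gamma : Prop :=
  forall s, 0 <= s <= 1 -> {for s, continuous gamma} /\
    forall c, A c -> cdom c (gamma s) -> forall i : 'I_m,
      (\forall r \near s, derivable (coord c gamma i) r 1) /\
      {for s, continuous (derive1 (coord c gamma i))}.

Definition curve_length gamma (len : R) : Prop :=
  exists speed : R -> R,
    (forall s, 0 <= s <= 1 -> forall c, A c -> cdom c (gamma s) ->
       let v := velocity c gamma s in
       speed s = Num.sqrt ((v *m G c (cmap c (gamma s)) *m v^T) 0 0)) /\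
    len = \int[lebesgue_measure]_(s in `[0, 1]) speed s.

Definition dist_to (Q : set M) (p : M) : R :=
  inf [set len | exists gamma,
    [/\ C1_curve gamma, Q (gamma 0), gamma 1 = p & curve_length gamma len]].

End Metric.

Section CohomogeneityOne.
Variables (M P : topologicalType) (n : nat).
Variables (A : set (chart M n.+1)) (B : set (chart P n)).
Variable G : chart M n.+1 -> 'rV[R]_n.+1 -> 'M[R]_n.+1.
Variables (Q : set M) (Phi : R -> P -> M) (proj : M -> P).

(* The chart (t, x) of the complement of Q induced by a chart c of P, where Phi
   is the identification of (0, oo) * P with this complement, whose inverse is
   (dist_to A G Q, proj). *)
Definition prod_chart (c : chart P n) : chart M n.+1 :=
  @Chart M (1 + n)
    [set p | ~ Q p /\ cdom c (proj p)]
    (fun p => row_mx (dist_to A G Q p)%:M (cmap c (proj p)))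
    (fun y => Phi (lsubmx y 0 0) (cinv c (rsubmx y))).

Definition prod_metric (c : chart P n) (t : R) (x : 'rV[R]_n) : 'M[R]_(1 + n) :=
  G (prod_chart c) (row_mx t%:M x).

(* components of g_t, where the metric is dt^2 + g_t *)
Definition slice_metric (c : chart P n) (t : R) (x : 'rV[R]_n) : 'M[R]_n :=
  drsubmx (prod_metric c t x).

(* components of L_t, i.e. the solution of d/dt g_t = 2 g_t L_t *)
Definition shape_operator (c : chart P n) (t : R) (x : 'rV[R]_n) : 'M[R]_n :=
  2^-1 *: (invmx (slice_metric c t x) *m
           \matrix_(i, j) derive1 (fun s => slice_metric c s x i j) t).

(* Slice chart of Q, of codimension k + 1, where the last k + 1 coordinates y
   satisfy t = |y|: the hypersurfaces P_t are the bundles of the k-spheres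
   |y| = t over Q = {y = 0}. *)
Definition collapse_chart (k : nat) (c : chart M n.+1) : Prop :=
  forall p, cdom c p ->
    (Q p <-> forall i : 'I_n.+1, (n - k <= i)%N -> cmap c p 0 i = 0) /\
    dist_to A G Q p =
      Num.sqrt (\sum_(i < n.+1 | (n - k <= i)%N) cmap c p 0 i ^+ 2).

Record cohomogeneity_one (k : nat) (u : M -> R) : Prop := {
  coh_noncompact : ~ compact [set: M];
  coh_fibre_manifold : smooth_manifold B;
  coh_fibre_compact : compact [set: P];
  coh_orbit_compact : compact Q;
  coh_sphere_dim : (1 <= k <= n)%N;
  coh_collapse : forall q, Q q ->
    exists c, [/\ A c, cdom c q & collapse_chart k c];
  coh_Phi : forall t p, 0 < t ->
    [/\ ~ Q (Phi t p), dist_to A G Q (Phi t p) = t & proj (Phi t p) = p];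
  coh_Phi_onto : forall p, ~ Q p ->
    0 < dist_to A G Q p /\ Phi (dist_to A G Q p) (proj p) = p;
  (* As A is maximal, this says that the bijection Phi is a diffeomorphism. *)
  coh_Phi_diffeo : forall c, B c -> A (prod_chart c);
  coh_metric : forall c, B c -> forall t x, 0 < t -> crange c x ->
    prod_metric c t x = block_mx 1%:M 0 0 (slice_metric c t x);
  coh_scalar : exists S : R -> R,
    forall c, B c -> forall t x, 0 < t -> crange c x ->
      scalar_curvature (slice_metric c t) x = S t;
  coh_mean_curvature : exists H : R -> R,
    forall c, B c -> forall t x, 0 < t -> crange c x ->
      \tr (shape_operator c t x) = H t;
  coh_potential : exists2 v : R -> R,
    v 0 = 0 & forall p, u p = v (dist_to A G Q p) }.

End CohomogeneityOne.
End Manifolds.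

(* Main.v *)
(** Write [p] for the derivative of the potential along [t], [H] for the mean
    curvature and [N] for [tr (L ^ 2)].  The component [Ric(d/dt, d/dt)] gives
    [H' = p' + eps / 2 - N], and the [d/dt]-component of the contracted second
    Bianchi identity, applied to the Ricci tensor expressed by the soliton
    equation, gives [p'' + (H - p) p' = (N + eps / 2) p].  Moreover
    [H ^ 2 <= n N], and [p] tends to [0] at the special orbit, because there the
    potential is a smooth even function of [t].  As the metric is not Einstein,
    [p] does not vanish identically, so [p] and [p'] have the same sign at some
    time, hence ever after.  If they are positive, [p' >= d p ^ 2] for some
    [d > 0] and [p] blows up in finite time.  So they are negative, and
    [H' < eps / 2 - H ^ 2 / n]: once below [sqrt (n eps / 2)], [H] stays below.
    If [H] never got there, [p] would stay bounded although [p'] tends to minus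
    infinity. *)

(* The equation for [p1] has a damping coefficient [H - p] of unknown sign. In the growing case the
   trace inequality makes up for this: wherever [p1 = d p ^ 2], completing a square in [H] absorbs
   the damping into [N p], which works once [d (2 + n) < 1]. In the decaying case the damping term
   drops out where [p1 = 0].

   A common sign of [p] and [p1] comes from [p ^ 2]. It is smaller near the orbit than at a time
   where [p] is nonzero, so its derivative [2 p p1] is positive in between.

   The intrinsic curvature of the slices never has to be computed. Besides [Ric(d/dt, d/dt)], only
   the contracted Bianchi identity enters, and its Ricci tensor is replaced by the Hessian of the
   potential. Christoffel symbols are grouped into matrices [Gam k], and one curvature index is
   raised, so that both contractions become plain sums over entries.

   All functions of [t] are read off along a single ray of one product chart; the constancy of the
   mean curvature on each slice carries the result to all other points. *)
Require Import Defs.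
From HB Require Import structures.
From mathcomp Require Import all_boot all_order all_algebra ring lra.
From mathcomp Require Import all_classical all_reals all_analysis.
Import Order.TTheory GRing.Theory Num.Theory numFieldNormedType.Exports.
Local Open Scope classical_set_scope.
Local Open Scope ring_scope.
Set Implicit Arguments.
Unset Strict Implicit.
Unset Printing Implicit Defensive.

(** * A Riccati-type system *)

Section DeriveFun.
Variables (R : realType) (V : normedModType R).
Implicit Types (f g : V -> R) (x v : V).

Lemma is_derive_add f g x v df dg : is_derive x v f df -> is_derive x v g dg ->
  is_derive x v (fun y => f y + g y) (df + dg).
Proof. by move=> ? ?; exact: is_deriveD. Qed.

Lemma is_derive_opp f x v df : is_derive x v f df ->
  is_derive x v (fun y => - f y) (- df).
Proof. by move=> ?; exact: is_deriveN. Qed.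

Lemma is_derive_mul f g x v df dg : is_derive x v f df -> is_derive x v g dg ->
  is_derive x v (fun y => f y * g y) (df * g x + f x * dg).
Proof.
move=> ? ?; rewrite addrC [df * _]mulrC; exact: is_deriveM.
Qed.

Lemma is_derive_inv f x v df : f x != 0 -> is_derive x v f df ->
  is_derive x v (fun y => (f y)^-1) (- (f x) ^- 2 * df).
Proof.
move=> fx [? <-]; split; first exact: derivableV.
by rewrite deriveV.
Qed.

Lemma is_derive_const (c : R) x v : is_derive x v (fun=> c) 0.
Proof. exact: is_derive_cst. Qed.

End DeriveFun.

Lemma is_derive_congr (R : realType) (V : normedModType R) (f g : V -> R)
    (x v : V) df dg :
  is_derive x v f df -> f =1 g -> df = dg -> is_derive x v g dg.
Proof. by move=> ? /funext <- <-. Qed.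

(** Only the left side matters: a function that is positive before [s] cannot arrive at the value
    zero with a positive slope. *)
Lemma derive_gt0_left (R : realType) (f : R -> R) (s d : R) :
  is_derive s 1 f d -> 0 < d ->
  exists2 e : R, 0 < e & forall r, s - e < r -> r < s -> f r < f s.
Proof.
move=> [/cvg_ex[l hl] hd] d0.
have ld : l = d by rewrite -hd; apply/esym/cvg_lim.
move: hl; rewrite ld => /cvgrPdist_lt/(_ _ d0)[e /= e0 he].
exists e => // r r1 r2.
have := he (r - s); rewrite /ball_ /= sub0r normrN ltr0_norm ?subr_lt0// opprB.
have rs : r - s != 0 by rewrite subr_eq0 lt_eqF.
move=> /(_ _ rs); rewrite ltrBlDr -ltrBlDl => /(_ r1).
have -> : (r - s) *: (1 : R) + s = r by rewrite [_ *: _]mulr1 subrK.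
move=> /(le_lt_trans (ler_norm _)).
rewrite ltrBlDr -ltrBlDl subrr [_ *: _]mulrC.
have : (r - s)^-1 < 0 by rewrite invr_lt0 subr_lt0.
by nra.
Qed.

Lemma is_derive_continuous (R : realType) (f : R -> R) (s d : R) :
  is_derive s 1 f d -> {for s, continuous f}.
Proof. by move=> [/derivable1_diffP/differentiable_continuous]. Qed.

Lemma is_derive_mvt (R : realType) (f df : R -> R) (a b : R) :
  a < b -> (forall x, a <= x <= b -> is_derive x 1 f (df x)) ->
  exists2 c, a < c < b & f b - f a = df c * (b - a).
Proof.
move=> ab fd.
have [||c cab ->] := @MVT R f df a b ab.
- by move=> x; rewrite in_itv /= => /andP[ax xb]; apply: fd; rewrite !ltW.
- by apply: derivable_within_continuous => x; rewrite in_itv /= => /fd[].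
- by exists c => //; move: cab; rewrite in_itv.
Qed.

Lemma is_derive_le_linear (R : realType) (f df : R -> R) (a b t : R) :
  (forall x, a <= x -> is_derive x 1 f (df x)) ->
  (forall x, a <= x -> df x <= b) -> a <= t -> f t <= f a + b * (t - a).
Proof.
move=> fd dfb; rewrite le_eqVlt => /predU1P[<-|at_].
  by rewrite subrr mulr0 addr0.
have [|c /andP[ac ct] ftfa] := @is_derive_mvt R f df a t at_.
  by move=> x /andP[ax _]; exact: fd.
rewrite -lerBlDl ftfa ler_pM2r ?subr_gt0//.
exact/dfb/ltW.
Qed.

(** At a first zero, reached from positive values, the derivative could not be positive. The sign of
    [df] is requested only there, with positivity on all of [[a, s)] at hand, so that consequences
    of the inequality up to time [s] may be used to prove it. *)
Lemma stays_gt0 (R : realType) (f df : R -> R) (a : R) :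
  (forall t, a <= t -> is_derive t 1 f (df t)) -> 0 < f a ->
  (forall s, a < s -> f s = 0 -> (forall r, a <= r < s -> 0 < f r) -> 0 < df s) ->
  forall t, a <= t -> 0 < f t.
Proof.
move=> fd fa hs t at_; rewrite ltNge; apply/negP => ft.
(* Let [s] be the supremum of the times up to which [f] is positive. Continuity excludes [f s < 0],
   the slope excludes [f s = 0], and if [f s > 0] continuity puts a time beyond [s] into [S]. *)
pose S := [set r | a <= r <= t /\ forall x, a <= x <= r -> 0 < f x].
have Sa : S a.
  split; first by rewrite lexx.
  by move=> x; rewrite -eq_le => /eqP <-.
have St : ubound S t by move=> r [/andP[]].
have hS : has_sup S by split; [exists a | exists t].
pose s := sup S.
have as_ : a <= s by apply: ub_le_sup => //; exists t.
have st : s <= t by apply: ge_sup => //; exists a.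
have below r : a <= r < s -> 0 < f r.
  move=> /andP[ar rs]; have rs0 : 0 < s - r by rewrite subr_gt0.
  have [x Sx rx] := sup_adherent rs0 hS.
  by apply: (Sx.2); rewrite ar /= ltW//; move: rx; rewrite -/s subKr.
have fs0 : 0 <= f s.
  rewrite leNgt; apply/negP => fs.
  have as1 : a < s.
    by rewrite lt_neqAle as_ andbT; apply/eqP => sa; rewrite -sa ltNge ltW in fs.
  have /cvgrPdist_lt/(_ (- f s)) := is_derive_continuous (fd s as_).
  rewrite oppr_gt0 => /(_ fs)[e /= e0 he].
  pose r := Num.max a (s - e / 2).
  have rs : r < s by rewrite gt_max as1 ltrBlDr ltrDl divr_gt0.
  have ar : a <= r by rewrite le_max lexx.
  have er : s - e / 2 <= r by rewrite le_max lexx orbT.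
  have := below r; rewrite ar rs => /(_ isT) fr.
  have := he r; rewrite /ball_ /= gtr0_norm ?subr_gt0// => /(_ _).
  have -> : s - r < e by lra.
  by move=> /(_ isT); rewrite ltr0_norm; lra.
have [fs|] := ltP 0 (f s); last first.
  move=> fs1; have fs : f s = 0 by apply/le_anti; rewrite fs0 fs1.
  have as1 : a < s.
    by rewrite lt_neqAle as_ andbT; apply/eqP => sa; rewrite sa fs ltxx in fa.
  have dfs := hs _ as1 fs below.
  have [e e0 he] := derive_gt0_left (fd s as_) dfs.
  pose r := Num.max a (s - e / 2).
  have rs : r < s by rewrite gt_max as1 ltrBlDr ltrDl divr_gt0.
  have ar : a <= r by rewrite le_max lexx.
  have er : s - e / 2 <= r by rewrite le_max lexx orbT.
  have := below r; rewrite ar rs => /(_ isT) fr.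
  have : f r < f s by apply: he => //; lra.
  by lra.
have st1 : s < t.
  by rewrite lt_neqAle st andbT; apply/eqP => e; move: ft; rewrite leNgt -e fs.
have /cvgrPdist_lt/(_ _ fs)[e /= e0 he] := is_derive_continuous (fd s as_).
pose r := Num.min t (s + e / 2).
have sr : s < r by rewrite lt_min st1 ltrDl divr_gt0.
have rt : r <= t by rewrite ge_min lexx.
have re : r <= s + e / 2 by rewrite ge_min lexx orbT.
suff /(ub_le_sup hS.2) : S r by rewrite leNgt sr.
split; first by rewrite rt (le_trans as_ (ltW sr)).
move=> x /andP[ax xr]; have [xs|sx] := ltP x s; first by apply: below; rewrite ax.
have := he x; rewrite /ball_ /= distrC ger0_norm ?subr_ge0//.
have -> : x - s < e by lra.
move=> /(_ isT); rewrite ltr_norml; lra.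
Qed.

(** * The scalar system for potential and mean curvature *)

Section ScalarODE.
Variables (R : realType) (n : nat) (eps : R) (p p1 H N : R -> R) (a : R).
Hypothesis eps0 : 0 < eps.
Hypothesis n0 : (0 < n)%N.
Hypothesis dp : forall t, a <= t -> is_derive t 1 p (p1 t).
Hypothesis dp1 : forall t, a <= t ->
  is_derive t 1 p1 ((N t + eps / 2) * p t - (H t - p t) * p1 t).
Hypothesis dH : forall t, a <= t -> is_derive t 1 H (p1 t + eps / 2 - N t).
Hypothesis HN : forall t, a <= t -> H t ^+ 2 <= n%:R * N t.

Let nR0 : (0 : R) < n%:R. Proof. by rewrite ltr0n. Qed.

(* A bound [d * p ^ 2 < p1] with small [d] persists, and then [p] blows up in
   finite time. *)
Lemma ode_growth_false : 0 < p a -> 0 < p1 a -> False.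
Proof.
move=> pa p1a.
have [d [d0 dpa dn]] :
    exists d : R, [/\ 0 < d, d * p a ^+ 2 < p1 a & d * (2 + n%:R) < 1].
  (* The first entry gives [d * p a ^ 2 <= p1 a / 2], the second [d * (2 + n) <= 1 / 2]. *)
  exists (Num.min (p1 a / (2 * p a ^+ 2)) ((2 * (2 + n%:R))^-1)).
  have p2 : 0 < p a ^+ 2 by rewrite exprn_gt0.
  have n2 : 0 < 2 + n%:R :> R by rewrite addr_gt0.
  split.
  - by rewrite lt_min divr_gt0 ?mulr_gt0// invr_gt0 mulr_gt0.
  - rewrite -ltr_pdivlMr// gt_min; apply/orP; left.
    by rewrite invfM mulrA ltr_pM2r ?invr_gt0//; lra.
  - rewrite -ltr_pdivlMr// gt_min; apply/orP; right.
    by rewrite div1r ltf_pV2 ?posrE ?mulr_gt0//; lra.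
(* While the inequality holds, [p1] is positive and [p] increases; hence [p] is still positive at a
   first failure. *)
have mono s : a <= s -> (forall r, a <= r < s -> 0 < p1 r - d * p r ^+ 2) ->
    p a <= p s.
  rewrite le_eqVlt => /predU1P[<-//|as_] hr.
  have [|c /andP[ac cs] ps] := @is_derive_mvt R p p1 a s as_.
    by move=> x /andP[ax _]; apply: dp.
  rewrite -subr_ge0 ps mulr_ge0// ?subr_ge0 ?(ltW as_)//.
  have := hr c; rewrite (ltW ac) cs => /(_ isT).
  by have := sqr_ge0 (p c); nra.
have riccati t : a <= t -> 0 < p1 t - d * p t ^+ 2.
  apply: (@stays_gt0 R (fun t => p1 t - d * p t ^+ 2)
    (fun t => ((N t + eps / 2) * p t - (H t - p t) * p1 t)
       - d * (2 * p t * p1 t))).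
  - move=> {}t at_; have dpt := dp at_;     apply: is_derive_congr (is_derive_add (dp1 at_) (is_derive_opp
      (is_derive_mul (is_derive_const d t 1) (is_derive_mul dpt dpt)))) _ _ => //.
    by ring.
  - by rewrite subr_gt0.
  move=> s as_ /eqP; rewrite subr_eq0 => /eqP p1s hr.
  have ps : 0 < p s by apply: lt_le_trans (mono _ (ltW as_) hr).
  rewrite p1s; have := HN (ltW as_) => HNs.
  set x := p s in ps *; set h := H s in HNs *; set k := N s in HNs *.
  have -> : (k + eps / 2) * x - (h - x) * (d * x ^+ 2)
       - d * (2 * x * (d * x ^+ 2)) =
     x * (k + eps / 2 - h * d * x + d * x ^+ 2 - 2 * d ^+ 2 * x ^+ 2) by ring.
  apply: mulr_gt0 => //.
  suff : 0 < n%:R * (k + eps / 2 - h * d * x + d * x ^+ 2 - 2 * d ^+ 2 * x ^+ 2).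
    by rewrite pmulr_rgt0.
  (* After [HN] replaces [n * k] by [h ^ 2], the goal is exactly the sum of [h1], [h2], three
     quarters of [h3] and half of [h4]. *)
  have h1 : 0 <= (h - n%:R * d * x / 2) ^+ 2 by exact: sqr_ge0.
  have h2 : 0 < n%:R * (d * x ^+ 2) * (1 - d * (2 + n%:R)).
    by rewrite !mulr_gt0 ?exprn_gt0 ?subr_gt0.
  have h3 : 0 <= n%:R ^+ 2 * d ^+ 2 * x ^+ 2 by rewrite -!exprMn sqr_ge0.
  have h4 : 0 < n%:R * eps by rewrite mulr_gt0.
  lra.
have ppos t : a <= t -> 0 < p t.
  move=> at_; apply: lt_le_trans pa _; apply: mono => // r /andP[ar _].
  exact: riccati.
(* The derivative of [1 / p] is at most [- d]; this is the time at which the resulting linear bound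
   reaches zero. *)
pose t := a + (p a)^-1 / d.
have at_ : a <= t by rewrite lerDl divr_ge0 ?invr_ge0 ?ltW.
have := ppos _ at_; apply/negP; rewrite -leNgt -invr_le0.
have := @is_derive_le_linear R (fun t => (p t)^-1) (fun t => - (p t) ^- 2 * p1 t)
   a (- d) t.
have -> : (p a)^-1 + - d * (t - a) = 0.
  by rewrite /t addrAC subrr add0r; field; rewrite !gt_eqF.
apply => //.
- move=> x ax; have dpx := dp ax.
  have px : p x != 0 by rewrite gt_eqF// ppos.
  exact: is_derive_inv.
- move=> x ax; have px := ppos _ ax; have := riccati _ ax.
  rewrite subr_gt0 mulNr lerN2 => /ltW.
  by rewrite -ler_pdivlMr ?exprn_gt0// mulrC.
Qed.

(** At a first zero of [p1] the derivative of [p1] is [(N + eps / 2) p], which is negative because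
    [p] has decreased from [p a < 0]. *)
Lemma ode_decay_mono : p a < 0 -> p1 a < 0 ->
  forall t, a <= t -> p t <= p a /\ p1 t < 0.
Proof.
move=> pa p1a.
have mono s : a <= s -> (forall r, a <= r < s -> 0 < - p1 r) -> p s <= p a.
  rewrite le_eqVlt => /predU1P[<-//|as_] hr.
  have [|c /andP[ac cs] ps] := @is_derive_mvt R p p1 a s as_.
    by move=> x /andP[ax _]; apply: dp.
  rewrite -subr_le0 ps mulr_le0_ge0// ?subr_ge0 ?(ltW as_)//.
  by have := hr c; rewrite (ltW ac) cs oppr_gt0 => /(_ isT)/ltW.
have neg t : a <= t -> 0 < - p1 t.
  apply: (@stays_gt0 R (fun t => - p1 t)
    (fun t => - ((N t + eps / 2) * p t - (H t - p t) * p1 t))).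
  - by move=> {}t at_; apply: is_derive_opp; exact: dp1.
  - by rewrite oppr_gt0.
  move=> s as_ /eqP; rewrite oppr_eq0 => /eqP p1s hr.
  rewrite p1s mulr0 subr0 oppr_gt0 pmulr_rlt0.
    by apply: le_lt_trans pa; exact: mono (ltW as_) hr.
  have : 0 <= n%:R * N s by apply: le_trans (HN (ltW as_)); exact: sqr_ge0.
  by rewrite pmulr_rge0// => Ns; rewrite ltr_wpDl// divr_gt0.
move=> t at_; rewrite -oppr_gt0 neg//; split => //.
by apply: mono => // r /andP[ar _]; exact: neg.
Qed.

Lemma ode_decay_bound : p a < 0 -> p1 a < 0 ->
  exists2 t1, a <= t1 & forall t, t1 <= t -> H t < Num.sqrt (n%:R * eps / 2).
Proof.
move=> pa p1a; have mono := ode_decay_mono pa p1a.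
set h := Num.sqrt _.
have h2 : h ^+ 2 = n%:R * eps / 2.
  by rewrite sqr_sqrtr// divr_ge0// mulr_ge0// ltW.
have h0 : 0 < h by rewrite sqrtr_gt0 divr_gt0// mulr_gt0.
(* While [H >= h], this makes [H' = p1 + eps / 2 - N] at most [p1], hence negative. *)
have Nge t : a <= t -> h <= H t -> eps / 2 <= N t.
  move=> at_ hH; rewrite -(ler_pM2l nR0).
  apply: le_trans (HN at_); rewrite mulrA -h2.
  by rewrite !expr2 ler_pM// ltW.
have [[t0 at0 Ht0]|/forall2NP hH] :=
    pselect (exists2 t0, a <= t0 & H t0 < h).
  exists t0 => // t tt; rewrite -subr_gt0.
  apply: (@stays_gt0 R (fun t => h - H t)
      (fun t => - (p1 t + eps / 2 - N t)) t0) tt.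
  - move=> s /(le_trans at0) as_; 
    exact: is_derive_congr (is_derive_add (is_derive_const h s 1)
      (is_derive_opp (dH as_))) (fun=> erefl) (add0r _).
  - by rewrite subr_gt0.
  - move=> s /ltW/(le_trans at0) as_ /eqP; rewrite subr_eq0 => /eqP hs _.
    have := Nge _ as_; rewrite hs => /(_ (lexx _)).
    by have [_] := mono _ as_; lra.
have {}hH t : a <= t -> h <= H t.
  by move=> at_; have [//|/negP] := hH t; rewrite -leNgt.
(* If [H >= h] forever then [p] stays bounded, while [p1 + K * p] decreases at
   least linearly. *)
exfalso; pose K := H a - p a.
(* The derivative of [H - p] is [eps / 2 - N], nonpositive by [Nge]. *)
have xiK t : a <= t -> H t - p t <= K.
  move=> at_; have := @is_derive_le_linear R (fun t => H t - p t)
    (fun t => p1 t + eps / 2 - N t - p1 t) a 0 t.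
  rewrite mul0r addr0; apply => //.
  - by move=> x ax; apply: is_derive_add (dH ax) (is_derive_opp (dp ax)).
  - by move=> x ax; have := Nge _ ax (hH _ ax); lra.
have pK t : a <= t -> - K <= p t.
  by move=> at_; have := xiK _ at_; have := hH _ at_; lra.
have K0 : 0 < K by have := hH _ (lexx a); rewrite /K; lra.
pose b := eps / 2 * p a.
have b0 : b < 0 by rewrite pmulr_rlt0// divr_gt0.
(* The derivative of [p1 + K * p] is [(N + eps / 2) p + (K - (H - p)) p1]. The second term is
   nonpositive by [xiK], and the first is at most [eps / 2 * p a]. *)
have lin t : a <= t -> p1 t + K * p t <= p1 a + K * p a + b * (t - a).
  apply: (@is_derive_le_linear R (fun t => p1 t + K * p t)
   (fun t => ((N t + eps / 2) * p t - (H t - p t) * p1 t) + (0 * p t + K * p1 t))).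
  - move=> x ax; apply: is_derive_add (dp1 ax) _.
    exact: is_derive_mul (is_derive_const K x 1) (dp ax).
  - move=> x ax; rewrite /b.
    have := xiK _ ax; have := Nge _ ax (hH _ ax); have [] := mono _ ax.
    set y := p x; set y1 := p1 x; set k := N x; set xi := H x - y.
    move=> y_ y1_ k_ xi_.
    have e1 : 0 <= (K - xi) * - y1 by rewrite mulr_ge0 ?subr_ge0// oppr_ge0 ltW.
    have e2 : 0 <= k * - y.
      rewrite mulr_ge0//; first by apply: le_trans k_; rewrite divr_ge0// ltW.
      by rewrite oppr_ge0 (le_trans y_)// ltW.
    have e3 : 0 <= (eps / 2) * (p a - y) by rewrite mulr_ge0 ?subr_ge0// divr_ge0// ltW.
    lra.
(* From this time on, the linear bound together with [K * p >= - K ^ 2] forces [p1 <= - 1]. *)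
pose c := a + (- 1 - K ^+ 2 - p1 a - K * p a) / b.
pose t0 := Num.max a c.
have at0 : a <= t0 by rewrite le_max lexx.
have p1le t : t0 <= t -> p1 t <= - 1.
  move=> tt; have at_ := le_trans at0 tt.
  have ct : c <= t by apply: le_trans tt; rewrite le_max lexx orbT.
  have := lin _ at_; have := pK _ at_.
  have : b * (t - a) <= - 1 - K ^+ 2 - p1 a - K * p a.
    rewrite mulrC -ler_ndivrMr//; move: ct; rewrite /c; lra.
  set z := p1 t; set y := p t; set l := b * (t - a).
  by move=> e1 e2 e3; have : 0 <= K * (y + K);
    [by apply: mulr_ge0; lra|lra].
(* With slope at most [- 1], a further time [p t0 + K + 1] brings [p] down to [- K - 1], below the
   bound [pK]. *)
have := @is_derive_le_linear R p p1 t0 (- 1) (t0 + (p t0 + K + 1)).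
have pt0 : 0 <= p t0 + K + 1 by have := pK _ at0; lra.
have at1 : t0 <= t0 + (p t0 + K + 1) by rewrite lerDl.
move=> /(_ _ p1le at1); have := pK _ (le_trans at0 at1).
set y := p (t0 + _) => y1 y2.
have : y <= p t0 + -1 * (t0 + (p t0 + K + 1) - t0).
  by apply: y2 => x /(le_trans at0); exact: dp.
lra.
Qed.

End ScalarODE.

(** The smooth collapse enters only as smallness of [p] at arbitrarily small times. This provides an
    [s < t] with [|p s| < |p t|], from which [p ^ 2] must grow. *)
Lemma ode_mean_curvature_bound (R : realType) (n : nat) (eps : R)
    (p p1 H N : R -> R) :
  0 < eps -> (0 < n)%N ->
  (forall t : R, 0 < t -> is_derive t 1 p (p1 t)) ->
  (forall t : R, 0 < t ->
    is_derive t 1 p1 ((N t + eps / 2) * p t - (H t - p t) * p1 t)) ->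
  (forall t : R, 0 < t -> is_derive t 1 H (p1 t + eps / 2 - N t)) ->
  (forall t : R, 0 < t -> H t ^+ 2 <= n%:R * N t) ->
  (forall d : R, 0 < d -> exists2 s : R, 0 < s < d & `|p s| < d) ->
  (exists2 t : R, 0 < t & p t != 0) ->
  exists2 t1 : R, 0 < t1 & forall t, t1 < t -> H t < Num.sqrt (n%:R * eps / 2).
Proof.
move=> eps0 n0 dp dp1 dH HN p0 [t t0 pt].
have [s /andP[s0 st] ps] :
    exists2 s, 0 < s < t & `|p s| < `|p t|.
  have d0 : 0 < Num.min t `|p t| by rewrite lt_min t0 normr_gt0.
  have [s /andP[s0 sd] ps] := p0 _ d0.
  exists s; first by rewrite s0 (lt_le_trans sd)// ge_min lexx.
  by rewrite (lt_le_trans ps)// ge_min lexx orbT.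
have [|a /andP[sa at_] pp] := @is_derive_mvt R (fun t => p t * p t)
    (fun t => p1 t * p t + p t * p1 t) s t st.
  move=> x /andP[/(lt_le_trans s0)/dp dpx _]; exact: is_derive_mul.
have a0 : 0 < a by exact: lt_trans sa.
have ppa : 0 < p a * p1 a.
  have : 0 < (p1 a * p a + p a * p1 a) * (t - s).
    rewrite -pp subr_gt0 -!expr2 -(real_normK (num_real (p s))).
    rewrite -(real_normK (num_real (p t))).
    by rewrite ltrXn2r ?nnegrE.
  by rewrite pmulr_lgt0 ?subr_gt0// [p1 a * _]mulrC -mulr2n pmulrn_lgt0.
have le0 x : a <= x -> 0 < x by exact: lt_le_trans.
have [pa|pa|pa] := ltgtP (p a) 0; last by rewrite pa mul0r ltxx in ppa.
- have p1a : p1 a < 0 by rewrite -(nmulr_rgt0 _ pa).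
  have [t1 at1 h] := @ode_decay_bound R n eps p p1 H N a eps0 n0
    (fun x ax => dp _ (le0 _ ax)) (fun x ax => dp1 _ (le0 _ ax))
    (fun x ax => dH _ (le0 _ ax)) (fun x ax => HN _ (le0 _ ax)) pa p1a.
  by exists t1 => [|x /ltW]; [exact: lt_le_trans at1|exact: h].
- have p1a : 0 < p1 a by rewrite -(pmulr_rgt0 _ pa).
  by have := @ode_growth_false R n eps p p1 H N a eps0 n0
    (fun x ax => dp _ (le0 _ ax)) (fun x ax => dp1 _ (le0 _ ax))
    (fun x ax => HN _ (le0 _ ax)) pa p1a.
Qed.

(** * Smooth functions on open sets *)

(** Both functions have the same value at [x] and the same first-order expansion there, so the
    differential of [f] also serves for [g]. *)
Lemma near_eq_differentiable (R : numFieldType) (V W : normedModType R)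
    (f g : V -> W) (x : V) :
  (\near x, f x = g x) -> differentiable f x -> differentiable g x.
Proof.
move=> fg dfx; have fgx : f x = g x by exact: nbhs_singleton fg.
have cdf := diff_continuous dfx.
have hg : g \o shift x = cst (g x) + 'd f x +o_ (nbhs (0:V)) id.
  have /eqaddoP h := diff_locally dfx.
  have c : (fun y : V => y + x) @ (0 : V) --> x.
    by rewrite -[X in _ --> X]add0r; apply: cvgD; [exact: cvg_id|exact: cvg_cst].
  have fg0 : \forall y \near (0 : V), f (y + x) = g (y + x) by exact: c fg.
  apply/eqaddoP => e e0; apply: filterS2 (h _ e0) fg0 => y /= + hy.
  by rewrite -[(f \o shift x - _) y]/(f (y + x) - (f x + 'd f x y)) hy fgx.
by apply/diff_locallyP; rewrite (diff_unique cdf hg).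
Qed.

Section SmoothFunctions.
Variables (R : realType) (m : nat).
Implicit Types (f g : 'rV[R]_m -> R) (U : set 'rV[R]_m) (x : 'rV[R]_m) (i : 'I_m).

Lemma is_derive_partial i f x : differentiable f x ->
  is_derive x (delta_mx 0 i) f (partial i f x).
Proof. by move=> /(@diff_derivable _ _ _ _ _ (delta_mx 0 i)) h; split. Qed.

Lemma near_eq_partial i f g x :
  (\near x, f x = g x) -> partial i f x = partial i g x.
Proof. exact: near_eq_derive. Qed.

Lemma partial_const i (c : R) x : partial i (fun=> c) x = 0.
Proof. exact: derive_cst. Qed.

Lemma partial_add i f g x : differentiable f x -> differentiable g x ->
  partial i (fun y => f y + g y) x = partial i f x + partial i g x.
Proof.
by move=> /(is_derive_partial i) df /(is_derive_partial i) dg;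
  case: (is_derive_add df dg).
Qed.

Lemma partial_opp i f x : differentiable f x ->
  partial i (fun y => - f y) x = - partial i f x.
Proof. by move=> /(is_derive_partial i) df; case: (is_derive_opp df). Qed.

Lemma partial_mul i f g x : differentiable f x -> differentiable g x ->
  partial i (fun y => f y * g y) x = partial i f x * g x + f x * partial i g x.
Proof.
by move=> /(is_derive_partial i) df /(is_derive_partial i) dg;
  case: (is_derive_mul df dg).
Qed.

Lemma partial_inv i f x : f x != 0 -> differentiable f x ->
  partial i (fun y => (f y)^-1) x = - (f x)^-1 * (f x)^-1 * partial i f x.
Proof.
move=> fx /(is_derive_partial i) df; case: (is_derive_inv fx df) => _.
by rewrite /partial => ->; rewrite expr2 invfM !mulNr.
Qed.

Lemma differentiable_add f g x : differentiable f x -> differentiable g x ->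
  differentiable (fun y => f y + g y) x.
Proof. exact: differentiableD. Qed.

Lemma differentiable_mul f g x : differentiable f x -> differentiable g x ->
  differentiable (fun y => f y * g y) x.
Proof. exact: differentiableM. Qed.

(** Truncation at order [k] permits induction: a derivative of a product or of an inverse is built
    from factors of one order less. *)
Definition smooth_upto (k : nat) U f : Prop :=
  forall (s : seq 'I_m) x, (size s <= k)%N -> U x ->
    differentiable (foldr (@partial R m) f s) x.

Lemma smooth_uptoP U f : smooth_on U f <-> forall k, smooth_upto k U f.
Proof.
by split=> [h k s x _ /h|h s x Ux]; [exact|exact: (h (size s))].
Qed.

Lemma smooth_upto0 U f :
  smooth_upto 0 U f <-> forall x, U x -> differentiable f x.
Proof.
by split=> [h x Ux|h s x]; [exact: (h [::])|rewrite leqn0 size_eq0 => /eqP ->; exact: h].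
Qed.

(** [foldr] applies the last index of the list first, so the innermost derivative is split off with
    [rcons]. *)
Lemma smooth_uptoS k U f : smooth_upto k.+1 U f <->
  (forall x, U x -> differentiable f x) /\
  forall i, smooth_upto k U (partial i f).
Proof.
split=> [h|[h0 h]].
  split=> [x Ux|i s x sk Ux]; first exact: (h [::]).
  by rewrite -foldr_rcons; apply: h => //; rewrite size_rcons.
move=> s x; case/lastP: s => [_ /h0//|s i].
by rewrite size_rcons foldr_rcons ltnS; exact: h.
Qed.

Lemma smooth_uptoW k l U f : (k <= l)%N ->
  smooth_upto l U f -> smooth_upto k U f.
Proof. by move=> kl h s x sk; apply: h; exact: leq_trans kl. Qed.

Section OpenDomain.
Variable U : set 'rV[R]_m.
Hypothesis oU : open U.

Lemma near_eq_on f g x : {in U, f =1 g} -> U x -> \near x, f x = g x.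
Proof.
move=> fg Ux; apply: filterS (open_nbhs_nbhs (conj oU Ux)) => y Uy.
by apply: fg; rewrite inE.
Qed.

Lemma eq_on_partial i f g : {in U, f =1 g} -> {in U, partial i f =1 partial i g}.
Proof. by move=> fg x; rewrite inE => Ux; apply/near_eq_partial/near_eq_on. Qed.

Lemma eq_on_differentiable f g x : {in U, f =1 g} -> U x ->
  differentiable f x -> differentiable g x.
Proof. by move=> fg Ux; apply/near_eq_differentiable/near_eq_on. Qed.

Lemma smooth_upto_ext k f g : {in U, f =1 g} ->
  smooth_upto k U f -> smooth_upto k U g.
Proof.
move=> fg h s x sk Ux; apply: eq_on_differentiable Ux (h _ _ sk Ux).
by elim: s {sk} => [//|i s IH] /=; exact: eq_on_partial.
Qed.

Lemma smooth_upto_add k f g : smooth_upto k U f -> smooth_upto k U g ->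
  smooth_upto k U (fun y => f y + g y).
Proof.
elim: k f g => [|k IH] f g.
  move=> /smooth_upto0 df /smooth_upto0 dg.
  by apply/smooth_upto0 => x Ux; apply: differentiable_add; [exact: df|exact: dg].
move=> /smooth_uptoS[df hf] /smooth_uptoS[dg hg]; apply/smooth_uptoS; split.
  by move=> x Ux; apply: differentiable_add; [exact: df|exact: dg].
move=> i; apply: smooth_upto_ext (IH _ _ (hf i) (hg i)) => x; rewrite inE => Ux.
by rewrite partial_add//; [exact: df|exact: dg].
Qed.

Lemma smooth_upto_mul k f g : smooth_upto k U f -> smooth_upto k U g ->
  smooth_upto k U (fun y => f y * g y).
Proof.
elim: k f g => [|k IH] f g.
  move=> /smooth_upto0 df /smooth_upto0 dg.
  by apply/smooth_upto0 => x Ux; apply: differentiable_mul; [exact: df|exact: dg].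
move=> hf1 hg1; have [hf0 hg0] := (smooth_uptoW (leqnSn k) hf1, smooth_uptoW (leqnSn k) hg1).
move: hf1 hg1 => /smooth_uptoS[df hf] /smooth_uptoS[dg hg]; apply/smooth_uptoS; split.
  by move=> x Ux; apply: differentiable_mul; [exact: df|exact: dg].
move=> i; apply: smooth_upto_ext (smooth_upto_add (IH _ _ (hf i) hg0) (IH _ _ hf0 (hg i))).
move=> x; rewrite inE => Ux.
by rewrite partial_mul//; [exact: df|exact: dg].
Qed.

Lemma smooth_upto_const k (c : R) : smooth_upto k U (fun=> c).
Proof.
elim: k c => [|k IH] c; first by apply/smooth_upto0 => x _; exact: differentiable_cst.
apply/smooth_uptoS; split=> [x _|i]; first exact: differentiable_cst.
by apply: smooth_upto_ext (IH 0) => x _; rewrite partial_const.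
Qed.

(** The derivative of [1 / f] is [- (1 / f) ^ 2] times that of [f], so [1 / f] itself is needed only
    to the previous order. *)
Lemma smooth_upto_inv k f : (forall x, U x -> f x != 0) -> smooth_upto k U f ->
  smooth_upto k U (fun y => (f y)^-1).
Proof.
move=> f0; elim: k => [|k IH].
  move=> /smooth_upto0 df; apply/smooth_upto0 => x Ux.
  by apply: differentiableV; [exact: df|exact: f0].
move=> hf1; have hf0 := smooth_uptoW (leqnSn k) hf1.
move: hf1 => /smooth_uptoS[df hf]; apply/smooth_uptoS; split.
  by move=> x Ux; apply: differentiableV; [exact: df|exact: f0].
move=> i; have hi := IH hf0.
have h := smooth_upto_mul (@smooth_upto_const k (-1))
  (smooth_upto_mul (smooth_upto_mul hi hi) (hf i)).
apply: smooth_upto_ext h.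
move=> x; rewrite inE => Ux.
by rewrite partial_inv ?mulN1r ?mulNr//; [exact: f0|exact: df].
Qed.

Lemma smooth_ext f g : {in U, f =1 g} -> smooth_on U f -> smooth_on U g.
Proof.
by move=> fg /smooth_uptoP hf; apply/smooth_uptoP => k; apply: smooth_upto_ext fg _.
Qed.

Lemma smooth_const (c : R) : smooth_on U (fun=> c).
Proof. by apply/smooth_uptoP => k; exact: smooth_upto_const. Qed.

Lemma smooth_add f g : smooth_on U f -> smooth_on U g ->
  smooth_on U (fun y => f y + g y).
Proof.
move=> /smooth_uptoP hf /smooth_uptoP hg; apply/smooth_uptoP => k.
exact: smooth_upto_add.
Qed.

Lemma smooth_mul f g : smooth_on U f -> smooth_on U g ->
  smooth_on U (fun y => f y * g y).
Proof.
move=> /smooth_uptoP hf /smooth_uptoP hg; apply/smooth_uptoP => k.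
exact: smooth_upto_mul.
Qed.

Lemma smooth_opp f : smooth_on U f -> smooth_on U (fun y => - f y).
Proof.
move=> hf; apply: smooth_ext (smooth_mul (smooth_const (-1)) hf) => x _.
by rewrite mulN1r.
Qed.

Lemma smooth_inv f : (forall x, U x -> f x != 0) -> smooth_on U f ->
  smooth_on U (fun y => (f y)^-1).
Proof.
move=> f0 /smooth_uptoP hf; apply/smooth_uptoP => k.
exact: smooth_upto_inv.
Qed.

Lemma smooth_sum (I : Type) (r : seq I) (P : pred I) (F : I -> 'rV[R]_m -> R) :
  (forall j, P j -> smooth_on U (F j)) ->
  smooth_on U (fun y => \sum_(j <- r | P j) F j y).
Proof.
move=> hF; elim: r => [|j r IH].
  by apply: smooth_ext (smooth_const 0) => x _; rewrite big_nil.
case Pj: (P j).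
  by apply: smooth_ext (smooth_add (hF j Pj) IH) => x _; rewrite big_cons Pj.
by apply: smooth_ext IH => x _; rewrite big_cons Pj.
Qed.

Lemma smooth_prod (I : Type) (r : seq I) (P : pred I) (F : I -> 'rV[R]_m -> R) :
  (forall j, P j -> smooth_on U (F j)) ->
  smooth_on U (fun y => \prod_(j <- r | P j) F j y).
Proof.
move=> hF; elim: r => [|j r IH].
  by apply: smooth_ext (smooth_const 1) => x _; rewrite big_nil.
case Pj: (P j).
  by apply: smooth_ext (smooth_mul (hF j Pj) IH) => x _; rewrite big_cons Pj.
by apply: smooth_ext IH => x _; rewrite big_cons Pj.
Qed.

Lemma smooth_partial i f : smooth_on U f -> smooth_on U (partial i f).
Proof.
move=> hf s x Ux.
by have := hf (rcons s i) x Ux; rewrite foldr_rcons.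
Qed.

Lemma smooth_differentiable f x : smooth_on U f -> U x -> differentiable f x.
Proof. by move=> hf; exact: (hf [::]). Qed.

Lemma smooth_det k (F : 'rV[R]_m -> 'M[R]_k) :
  (forall a b, smooth_on U (fun y => F y a b)) ->
  smooth_on U (fun y => \det (F y)).
Proof.
move=> hF; apply: smooth_sum => s _; apply: smooth_mul; first exact: smooth_const.
exact: smooth_prod.
Qed.

(** By Cramer's rule, the entries are cofactors divided by the determinant. *)
Lemma smooth_invmx k (F : 'rV[R]_m -> 'M[R]_k) a b :
  (forall a b, smooth_on U (fun y => F y a b)) ->
  (forall x, U x -> F x \in unitmx) ->
  smooth_on U (fun y => invmx (F y) a b).
Proof.
move=> hF uF.
apply: (@smooth_ext (fun y => (\det (F y))^-1 * cofactor (F y) b a)).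
  by move=> x; rewrite inE /invmx => /uF ->; rewrite !mxE.
apply: smooth_mul.
  apply: smooth_inv (smooth_det hF) => x /uF.
  by rewrite unitmxE unitfE.
apply: smooth_mul; first exact: smooth_const.
apply: smooth_det => c d; apply: smooth_ext (hF (lift b c) (lift a d)) => x _.
by rewrite !mxE.
Qed.

End OpenDomain.
End SmoothFunctions.

(** * Symmetry of second partial derivatives *)

Lemma is_derive_line (R : realType) (V : normedModType R) (f : V -> R)
    (x v : V) (a : R) :
  derivable f (x + a *: v) v ->
  is_derive a 1 (fun a : R => f (x + a *: v)) ('D_v f (x + a *: v)).
Proof.
move=> fv; set g := fun a : R => _.
have E : (fun h => h^-1 *: ((g \o shift a) (h *: (1 : R)) - g a)) =
    (fun h => h^-1 *: ((f \o shift (x + a *: v)) (h *: v) - f (x + a *: v))).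
  apply/funext => h; congr (_ *: (f _ - _)) => /=.
  by rewrite [_ *: (1 : R)]mulr1 scalerDl addrCA.
by split; rewrite /derivable /derive E.
Qed.

Section Schwarz.
Variables (R : realType) (m : nat) (U : set 'rV[R]_m) (f : 'rV[R]_m -> R).
Hypotheses (oU : open U) (sf : smooth_on U f).

Lemma is_derive_coord_line g i (x : 'rV[R]_m) (a : R) : smooth_on U g ->
  U (x + a *: delta_mx 0 i) ->
  is_derive a 1 (fun a : R => g (x + a *: delta_mx 0 i))
    (partial i g (x + a *: delta_mx 0 i)).
Proof.
move=> sg Ux; apply: is_derive_line; apply: diff_derivable.
exact: smooth_differentiable sg Ux.
Qed.

Lemma norm_delta_mx_le1 i : `|delta_mx 0 i : 'rV[R]_m| <= 1.
Proof.
rewrite /Num.Def.normr /= mx_normrE; apply: bigmax_le => //= -[a b] _.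
by rewrite mxE; case: eqP; rewrite ?normr0 ?normr1 ?ler01//; case: eqP; rewrite ?normr0 ?normr1 ?ler01.
Qed.

(** The mean value theorem applies twice: along [u] to the increment of [f] over the step [h *: v],
    then along [v] to [partial i f]. The distance bound uses that coordinate vectors have norm at
    most 1. *)
Lemma second_difference i j (x : 'rV[R]_m) (r h : R) :
  (forall y, `|y - x| < r -> U y) -> 0 < h -> 2 * h < r ->
  exists2 y, `|y - x| <= 2 * h &
    f (x + h *: delta_mx 0 i + h *: delta_mx 0 j) - f (x + h *: delta_mx 0 i)
    - (f (x + h *: delta_mx 0 j) - f x) = h ^+ 2 * partial j (partial i f) y.
Proof.
move=> rU h0 hr; set u : 'rV[R]_m := delta_mx 0 i; set v : 'rV[R]_m := delta_mx 0 j.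
have near_ab (a b : R) : 0 <= a <= h -> 0 <= b <= h ->
    `|(x + a *: u + b *: v) - x| <= 2 * h.
  move=> /andP[a0 ah] /andP[b0 bh].
  rewrite -[x + _ + _]addrA [x + _]addrC addrK (le_trans (ler_normD _ _))// !normrZ.
  have := norm_delta_mx_le1 i; have := norm_delta_mx_le1 j; rewrite -/u -/v.
  rewrite (ger0_norm a0) (ger0_norm b0) => v1 u1.
  have : a * `|u| <= a * 1 by rewrite ler_wpM2l.
  have : b * `|v| <= b * 1 by rewrite ler_wpM2l.
  lra.
have Uab (a b : R) : 0 <= a <= h -> 0 <= b <= h -> U (x + a *: u + b *: v).
  by move=> ha hb; apply: rU; apply: le_lt_trans hr; exact: near_ab.
have hh : 0 <= h <= h by rewrite lexx ltW.
have h00 : 0 <= (0 : R) <= h by rewrite lexx ltW.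
have [|a /andP[a0 ah]] := @is_derive_mvt R
   (fun a => f (x + h *: v + a *: u) - f (x + a *: u))
   (fun a => partial i f (x + h *: v + a *: u) - partial i f (x + a *: u)) 0 h h0.
  move=> a ha; apply: is_derive_add; first last.
    apply: is_derive_opp; apply: is_derive_coord_line => //.
    by rewrite -[X in U X]addr0 -(scale0r v); exact: Uab.
  by apply: is_derive_coord_line => //; rewrite addrAC; exact: Uab.
rewrite !scale0r !addr0 subr0 => D1.
have ha : 0 <= a <= h by rewrite !ltW.
have [|b /andP[b0 bh]] := @is_derive_mvt R
   (fun b => partial i f (x + a *: u + b *: v))
   (fun b => partial j (partial i f) (x + a *: u + b *: v)) 0 h h0.
  by move=> b hb; apply: is_derive_coord_line (Uab _ _ ha hb); exact: smooth_partial.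
rewrite !scale0r !addr0 subr0 => D2.
exists (x + a *: u + b *: v); first by apply: near_ab => //; rewrite !ltW.
rewrite [x + h *: u + _]addrAC opprB addrCA addrC -[RHS]mulrC.
rewrite expr2 mulrA -D2 [x + a *: u + _]addrAC -D1; ring.
Qed.
End Schwarz.

(** Meant for the two mixed derivatives, which the mean value theorem relates only at two different
    points [y] and [z] near [x]. *)
Lemma continuous_eq_of_near_values (R : realType) (V : normedModType R)
    (A B : V -> R) (x : V) :
  {for x, continuous A} -> {for x, continuous B} ->
  (forall r : R, 0 < r -> exists y z,
    [/\ `|y - x| < r, `|z - x| < r & A y = B z]) -> A x = B x.
Proof.
move=> cA cB AB; apply/eqP; rewrite -subr_eq0 -normr_le0.
apply/ler_addgt0Pl => e e0; rewrite addr0.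
have close (C : V -> R) : {for x, continuous C} ->
    exists2 r : R, 0 < r & forall y, `|y - x| < r -> `|C x - C y| < e / 2.
  have e20 : 0 < e / 2 by rewrite divr_gt0.
  move=> /cvgrPdist_lt/(_ _ e20)/nbhs_ballP[r r0 h].
  by exists r => // y yx; apply: h; rewrite -ball_normE /= distrC.
have [r1 r10 h1] := close _ cA; have [r2 r20 h2] := close _ cB.
have r0 : 0 < Num.min r1 r2 by rewrite lt_min r10.
have [y [z [yr zr AyBz]]] := AB _ r0.
have {}yr : `|y - x| < r1 by apply: lt_le_trans yr _; rewrite ge_min lexx.
have {}zr : `|z - x| < r2 by apply: lt_le_trans zr _; rewrite ge_min lexx orbT.
have := h1 _ yr; have := h2 _ zr; rewrite AyBz => l2 l1; rewrite [leRHS]splitr.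
rewrite -(subrKA (B z)).
apply: le_trans (ler_normD _ _) _; rewrite lerD ?(ltW l1)//.
by rewrite distrC ltW.
Qed.

(** The second difference over a square of side [h] is symmetric in [i] and [j], and it equals
    [h ^ 2] times either mixed derivative at a point within [2 * h] of [x]. *)
Lemma partial_comm (R : realType) (m : nat) (U : set 'rV[R]_m)
    (f : 'rV[R]_m -> R) i j x :
  open U -> smooth_on U f -> U x ->
  partial i (partial j f) x = partial j (partial i f) x.
Proof.
move=> oU sf Ux.
have cont g : smooth_on U g -> {for x, continuous g}.
  by move=> sg; apply/differentiable_continuous/(smooth_differentiable sg).
apply: continuous_eq_of_near_values.
- exact: cont (smooth_partial i (smooth_partial j sf)).
- exact: cont (smooth_partial j (smooth_partial i sf)).
move=> e e0.
have [r r0 rU] : exists2 r : R, 0 < r & forall y, `|y - x| < r -> U y.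
  have /nbhs_ballP[r r0 rU] := open_nbhs_nbhs (conj oU Ux).
  by exists r => // y yx; apply: rU; rewrite -ball_normE /= distrC.
have [h [h0 hr he]] : exists h : R, [/\ 0 < h, 2 * h < r & 2 * h < e].
  exists (Num.min r e / 3).
  have mr : Num.min r e <= r by rewrite ge_min lexx.
  have me : Num.min r e <= e by rewrite ge_min lexx orbT.
  have m0 : 0 < Num.min r e by rewrite lt_min r0.
  by move: (Num.min _ _) mr me m0 => q *; split; lra.
have [y yx Dy] := second_difference sf i j rU h0 hr.
have [z zx Dz] := second_difference sf j i rU h0 hr.
exists z, y; split; [exact: le_lt_trans he|exact: le_lt_trans he|].
have h20 : h ^+ 2 != 0 by rewrite gt_eqF// exprn_gt0.
move: Dy Dz; rewrite [x + h *: delta_mx 0 j + _]addrAC.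
move: (partial i _ _) (partial j _ _) (f _) (f _) (f _) (f _) => p q a b c d Dy Dz.
by apply: (mulfI h20); rewrite -Dy -Dz; ring.
Qed.

(** * Positive definite matrices *)

Section PositiveDefinite.
Variable R : rcfType.

(** Cholesky factorization by induction on the size: the Schur complement [S] of the corner entry
    [a] is positive definite again, and its factor completes a block lower triangular [W]. *)
Lemma posdef_factor n (G : 'M[R]_n) : G^T = G ->
  (forall v : 'rV[R]_n, v != 0 -> 0 < (v *m G *m v^T) 0 0) ->
  exists2 W : 'M[R]_n, W \in unitmx & G = W *m W^T.
Proof.
elim: n G => [|n IH] G symG posG.
  by exists 1%:M; [exact: unitmx1|apply/matrixP => -[]].
move: G symG posG; rewrite -[n.+1]/(1 + n)%N => G symG posG.
pose a := G 0 0; pose b : 'rV_n := ursubmx (G : 'M[R]_(1 + n)).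
pose D := drsubmx (G : 'M[R]_(1 + n)).
have EG : G = block_mx a%:M b b^T D.
  rewrite -[LHS](@submxK _ 1 n 1 n); congr (@block_mx _ 1 n 1 n _ _ _ _).
    by rewrite [LHS]mx11_scalar; congr (_%:M); rewrite !mxE; congr (G _ _); apply/val_inj.
  by rewrite -{1}symG -trmx_ursub.
have symD : D^T = D by rewrite /D trmx_drsub symG.
have a0 : 0 < a.
  have := posG (row_mx 1%:M 0); rewrite EG mul_row_block !mul1mx !mul0mx !addr0.
  rewrite tr_row_mx mul_row_col trmx1 mulmx1 trmx0 mulmx0 addr0 mxE eqxx; apply.
  apply/eqP => /(congr1 (fun M : 'rV_(1 + n) => lsubmx M 0 0)).
  by rewrite row_mxKl !mxE eqxx => /eqP; rewrite oner_eq0.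
pose S := D - a^-1 *: (b^T *m b).
have [|v v0|W uW ES] := IH S.
- by rewrite /S linearB linearZ /= trmx_mul trmxK symD.
(* For fixed [v] this first coordinate minimizes the quadratic form of [G]; the minimum is
   [v S v^T]. *)
- have := posG (row_mx (- a^-1 *: (v *m b^T)) v).
  have nz : row_mx (- a^-1 *: (v *m b^T)) v != 0.
    by apply: contra_neq v0 => /(congr1 (@rsubmx _ 1 1 n)); rewrite row_mxKr linear0.
  move=> /(_ nz); rewrite EG mul_row_block tr_row_mx mul_row_col.
  rewrite -scalemxAl mul_mx_scalar scalerA mulNr mulVf ?gt_eqF// scaleN1r.
  rewrite addNr mul0mx add0r /S mulmxBr -scalemxAr -scalemxAl mulmxA scaleNr.
  by rewrite addrC.
pose s := Num.sqrt a.
have s0 : s != 0 by rewrite gt_eqF// sqrtr_gt0.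
have ss : s * s = a by rewrite -expr2 sqr_sqrtr// ltW.
exists (block_mx s%:M 0 (s^-1 *: b^T) W).
  by rewrite unitmxE det_lblock det_scalar1 unitrM unitfE s0 -unitmxE.
rewrite EG tr_block_mx mulmx_block !mul0mx !trmx0 !mulmx0 !addr0.
rewrite tr_scalar_mx -scalar_mxM ss linearZ /= trmxK.
rewrite mul_scalar_mx scalerA mulfV// scale1r.
rewrite mul_mx_scalar scalerA mulfV// scale1r -ES.
by rewrite -scalemxAl -scalemxAr scalerA -invfM ss /S addrC subrK.
Qed.

Lemma posdef_unitmx n (G : 'M[R]_n) : G^T = G ->
  (forall v : 'rV[R]_n, v != 0 -> 0 < (v *m G *m v^T) 0 0) -> G \in unitmx.
Proof.
by move=> symG posG; have [W uW ->] := posdef_factor symG posG;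
  rewrite unitmx_mul unitmx_tr uW.
Qed.

(** With [G = W W^T] and [V = invmx W], the matrix [invmx G *m K] is similar to the symmetric
    [M = V K V^T], and the trace of [M ^ 2] is the sum of the squares of its entries. *)
Lemma posdef_trace_sqr_ge0 n (G K : 'M[R]_n) : G^T = G -> K^T = K ->
  (forall v : 'rV[R]_n, v != 0 -> 0 < (v *m G *m v^T) 0 0) ->
  0 <= \tr (invmx G *m K *m (invmx G *m K)).
Proof.
move=> symG symK posG; have [W uW EG] := posdef_factor symG posG.
pose V := invmx W; pose M := V *m K *m V^T.
have EV : invmx G = V^T *m V.
  have uG := posdef_unitmx symG posG.
  have VG : V^T *m V *m G = 1%:M.
    rewrite EG -(mulmxA V^T) (mulmxA V) mulVmx// mul1mx -trmx_mul mulmxV//.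
    exact: trmx1.
  by rewrite -[RHS]mulmx1 -(mulmxV uG) mulmxA VG mul1mx.
have -> : \tr (invmx G *m K *m (invmx G *m K)) = \tr (M *m M^T).
  rewrite EV -mulmxA -mulmxA mxtrace_mulC /M !trmx_mul trmxK symK.
  by rewrite !mulmxA.
rewrite /mxtrace sumr_ge0// => i _; rewrite mxE sumr_ge0// => j _.
by rewrite [M^T j i]mxE -expr2 sqr_ge0.
Qed.
End PositiveDefinite.

(** * The contracted second Bianchi identity *)

Section MatrixCalculus.
Variables (R : realType) (m : nat) (U : set 'rV[R]_m).
Hypothesis oU : open U.
(* Keeps unification from unfolding [partial i f x] down to the limit when it
   differs from [partial j f x]. *)
#[local] Opaque partial.
Local Notation mxfun := ('rV[R]_m -> 'M[R]_m).
Implicit Types (F H : mxfun) (x : 'rV[R]_m) (i j k : 'I_m).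

Lemma partial_sum (I : Type) (r : seq I) (f : I -> 'rV[R]_m -> R) k x :
  (forall l, differentiable (f l) x) ->
  partial k (fun y => \sum_(l <- r) f l y) x = \sum_(l <- r) partial k (f l) x.
Proof.
move=> df; suff [_ //] : differentiable (fun y => \sum_(l <- r) f l y) x /\
  partial k (fun y => \sum_(l <- r) f l y) x = \sum_(l <- r) partial k (f l) x.
elim: r => [|l r [IH1 IH2]].
  under eq_fun do rewrite big_nil.
  by rewrite big_nil partial_const; split => //; exact: differentiable_cst.
under eq_fun do rewrite big_cons.
split; first exact: differentiable_add.
by rewrite big_cons partial_add// IH2.
Qed.

Definition smooth_mx F := forall a b, smooth_on U (fun y => F y a b).

Definition partial_mx k F : mxfun :=
  fun x => \matrix_(a, b) partial k (fun y => F y a b) x.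

Lemma partial_mxE k F x a b :
  partial_mx k F x a b = partial k (fun y => F y a b) x.
Proof. exact: mxE. Qed.

Lemma smooth_mx_differentiable F a b x :
  smooth_mx F -> U x -> differentiable (fun y => F y a b) x.
Proof. by move=> sF Ux; exact: smooth_differentiable (sF a b) Ux. Qed.

Lemma partial_mx_ext k F H : {in U, F =1 H} ->
  {in U, partial_mx k F =1 partial_mx k H}.
Proof.
move=> FH x Ux; apply/matrixP => a b; rewrite !mxE.
by apply: (eq_on_partial oU) => // y Uy; rewrite FH.
Qed.

Lemma smooth_partial_mx k F : smooth_mx F -> smooth_mx (partial_mx k F).
Proof.
move=> sF a b; apply: smooth_ext (smooth_partial k (sF a b)) => // x _.
by rewrite mxE.
Qed.

Lemma smooth_mx_add F H : smooth_mx F -> smooth_mx H ->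
  smooth_mx (fun x => F x + H x).
Proof.
move=> sF sH a b; apply: smooth_ext (smooth_add oU (sF a b) (sH a b)) => // x _.
by rewrite mxE.
Qed.

Lemma smooth_mx_opp F : smooth_mx F -> smooth_mx (fun x => - F x).
Proof.
move=> sF a b; apply: smooth_ext (smooth_opp oU (sF a b)) => // x _.
by rewrite mxE.
Qed.

Lemma smooth_mx_mul F H : smooth_mx F -> smooth_mx H ->
  smooth_mx (fun x => F x *m H x).
Proof.
move=> sF sH a b.
apply: (@smooth_ext _ _ _ oU (fun x => \sum_j F x a j * H x j b)).
  by move=> x _; rewrite mxE.
by apply: smooth_sum => // j _; exact: smooth_mul.
Qed.

Lemma smooth_mx_tr F : smooth_mx F -> smooth_mx (fun x => (F x)^T).
Proof.
by move=> sF a b; apply: smooth_ext (sF b a) => // x _; rewrite mxE.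
Qed.

Lemma smooth_mx_invmx F : smooth_mx F -> (forall x, U x -> F x \in unitmx) ->
  smooth_mx (fun x => invmx (F x)).
Proof. by move=> sF uF a b; exact: smooth_invmx. Qed.

Lemma partial_mx_add k F H x : smooth_mx F -> smooth_mx H -> U x ->
  partial_mx k (fun y => F y + H y) x = partial_mx k F x + partial_mx k H x.
Proof.
move=> sF sH Ux; apply/matrixP => a b; rewrite !mxE -partial_add.
- by congr (partial k _ x); apply/funext => y; rewrite mxE.
- exact: smooth_mx_differentiable.
- exact: smooth_mx_differentiable.
Qed.

Lemma partial_mx_opp k F x : smooth_mx F -> U x ->
  partial_mx k (fun y => - F y) x = - partial_mx k F x.
Proof.
move=> sF Ux; apply/matrixP => a b; rewrite !mxE -partial_opp.
- by congr (partial k _ x); apply/funext => y; rewrite mxE.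
- exact: smooth_mx_differentiable.
Qed.

Lemma partial_mx_mul k F H x : smooth_mx F -> smooth_mx H -> U x ->
  partial_mx k (fun y => F y *m H y) x =
  partial_mx k F x *m H x + F x *m partial_mx k H x.
Proof.
move=> sF sH Ux; apply/matrixP => a b; rewrite !mxE.
transitivity (partial k (fun y => \sum_j F y a j * H y j b) x).
  by congr (partial k _ x); apply/funext => y; rewrite mxE.
have dF c d := smooth_mx_differentiable c d sF Ux.
have dH c d := smooth_mx_differentiable c d sH Ux.
rewrite partial_sum; last by move=> j; exact: differentiable_mul.
by rewrite -big_split; apply: eq_bigr => j _ /=; rewrite partial_mul// !mxE.
Qed.

Lemma partial_mx_tr k F x : partial_mx k (fun y => (F y)^T) x = (partial_mx k F x)^T.
Proof.
apply/matrixP => a b; rewrite !mxE.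
by congr (partial k _ x); apply/funext => y; rewrite mxE.
Qed.

Lemma partial_mx_comm i j F x : smooth_mx F -> U x ->
  partial_mx i (partial_mx j F) x = partial_mx j (partial_mx i F) x.
Proof.
move=> sF Ux; apply/matrixP => a b.
have E c : (fun y => partial_mx c F y a b) = partial c (fun y => F y a b).
  by apply/funext => y; exact: partial_mxE.
have E2 c d : partial_mx c (partial_mx d F) x a b =
    partial c (partial d (fun y => F y a b)) x by rewrite partial_mxE E.
apply: etrans (E2 i j) _.
apply: etrans _ (esym (E2 j i)).
exact: (@partial_comm R m U (fun y => F y a b) i j x oU (sF a b) Ux).
Qed.

End MatrixCalculus.

(** * Tracing the second Bianchi identity at a point, as pure algebra *)

Section BianchiTrace.
Variables (R : realType) (m : nat).
Variables (A : 'I_m -> 'I_m -> 'M[R]_m) (DA : 'I_m -> 'I_m -> 'I_m -> 'M[R]_m).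
Variable G : 'I_m -> 'M[R]_m.
Hypothesis AC : forall i j, A j i = - A i j.
Hypothesis A_skew : forall i j, (A i j)^T = - A i j.
Hypothesis DAC : forall k i j, DA k j i = - DA k i j.
Hypothesis DA_skew : forall k i j, (DA k i j)^T = - DA k i j.
Hypothesis Gsym : forall i j l, G i l j = G j l i.
(** Here [A i j] stands for the entries R^ab_ij, [DA] for their partial derivatives and [G k] for
    the connection matrices. [C] is the covariant derivative in the upper indices, and [T] below is
    the Ricci tensor with one index raised. *)
Let C k i j := DA k i j + G k *m A i j + A i j *m (G k)^T.
Hypothesis bianchi : forall k i j, C k i j + C i j k + C j k i = 0.
Let T i e := \sum_l A l e l i.
Let DT k i e := \sum_l DA k l e l i.

Let flip (M : 'I_m -> 'I_m -> 'M[R]_m) : (forall i j, M j i = - M i j) ->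
  (forall i j, (M i j)^T = - M i j) -> forall i j a b, M i j a b = M j i b a.
Proof.
move=> MC Mskew i j a b; rewrite MC mxE.
by have /matrixP/(_ a b) := Mskew j i; rewrite !mxE => ->.
Qed.

Let Aneg i j a b : A i j a b = - A i j b a.
Proof. by have /matrixP/(_ b a) := A_skew i j; rewrite !mxE => ->. Qed.

Let DAneg k i j a b : DA k i j a b = - DA k i j b a.
Proof. by have /matrixP/(_ b a) := DA_skew k i j; rewrite !mxE => ->. Qed.

Let CC k i j : C k j i = - C k i j.
Proof. by rewrite /C DAC AC !mulNmx !mulmxN -!opprD. Qed.

Let C_skew k i j : (C k i j)^T = - C k i j.
Proof.
rewrite /C; move: (A i j) (DA k i j) (A_skew i j) (DA_skew k i j) (G k) => a d ska skd g.
rewrite linearD /= linearD /= !trmx_mul trmxK ska skd.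
by rewrite !mulNmx !mulmxN -!opprD addrAC.
Qed.

Let Cexp k i j a b : C k i j a b =
  DA k i j a b + \sum_p G k a p * A i j p b + \sum_p A i j a p * G k b p.
Proof.
rewrite !mxE; congr (_ + _ + _).
by apply: eq_bigr => p _; rewrite mxE.
Qed.

(** This contraction is the divergence of [T]. What is left over pairs [A e j], skew in its two
    entries, with connection coefficients symmetric in the same indices, so it vanishes. *)
Let sum_divergence e : \sum_k \sum_j C k e j k j =
  \sum_k DT k k e + \sum_k \sum_p G k k p * T p e.
Proof.
transitivity (\sum_k (DT k k e + \sum_p G k k p * T p e
    + \sum_j \sum_p A e j k p * G k j p)).
  apply: eq_bigr => k _; rewrite /DT /T.
  under [X in _ = _ + X + _]eq_bigr do rewrite mulr_sumr.
  rewrite [X in _ = _ + X + _]exchange_big -!big_split; apply: eq_bigr => j _ /=.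
  rewrite Cexp (flip (DAC k) (DA_skew k)); congr (_ + _ + _).
  by apply: eq_bigr => p _; rewrite (flip AC A_skew).
rewrite !big_split /= [X in _ + X]exchange_big /=.
rewrite [X in _ + X]big1 ?addr0// => j _.
set X := \sum_k _; have : X = - X.
  rewrite {1}/X exchange_big /X -sumrN; apply: eq_bigr => k _.
  rewrite -sumrN; apply: eq_bigr => p _.
  by rewrite Aneg Gsym mulNr.
lra.
Qed.

(** Here the upper indices meet the form indices in reversed order, whence the minus signs. The two
    connection terms give the same contraction with [T], whence the factor 2. *)
Let sum_scalar e : \sum_k \sum_j C e j k k j =
  - \sum_i DT e i i - 2 * \sum_k \sum_p G e k p * T p k.
Proof.
have S1 : \sum_k \sum_j DA e j k k j = - \sum_i DT e i i.
  rewrite -sumrN; apply: eq_bigr => k _; rewrite -sumrN; apply: eq_bigr => j _.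
  exact: DAneg.
have S2 : \sum_k \sum_j \sum_p G e k p * A j k p j =
    - \sum_k \sum_p G e k p * T p k.
  rewrite -sumrN; apply: eq_bigr => k _; rewrite exchange_big -sumrN.
  apply: eq_bigr => p _; rewrite mulr_sumr -sumrN; apply: eq_bigr => j _.
  by rewrite Aneg mulrN.
have S3 : \sum_k \sum_j \sum_p A j k k p * G e j p =
    - \sum_k \sum_p G e k p * T p k.
  rewrite exchange_big -sumrN; apply: eq_bigr => j _ /=.
  rewrite exchange_big -sumrN; apply: eq_bigr => p _ /=.
  rewrite mulr_sumr -sumrN; apply: eq_bigr => k _.
  by rewrite AC mxE mulNr mulrC.
have -> : \sum_k \sum_j C e j k k j = \sum_k \sum_j DA e j k k j
    + \sum_k \sum_j \sum_p G e k p * A j k p j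
    + \sum_k \sum_j \sum_p A j k k p * G e j p.
  rewrite -!big_split; apply: eq_bigr => k _; rewrite -!big_split /=.
  by apply: eq_bigr => j _; rewrite Cexp.
by rewrite S1 S2 S3; lra.
Qed.

(** Summing the entries [k j] of the cyclic identity for [k], [e], [j] contracts every form index
    but [e]. The first and third terms agree after renaming [k] and [j], which produces the factor
    2. *)
Lemma bianchi_trace e :
  2 * (\sum_k DT k k e + \sum_k \sum_p G k k p * T p e
       - \sum_k \sum_p G e k p * T p k) = \sum_i DT e i i.
Proof.
have sum3 : \sum_k \sum_j C j k e k j = \sum_k \sum_j C k e j k j.
  rewrite exchange_big; apply: eq_bigr => k _; apply: eq_bigr => j _.
  exact: flip (CC k) (C_skew k) _ _ _ _.
have : \sum_k \sum_j (C k e j + C e j k + C j k e) k j =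
    \sum_k \sum_j C k e j k j + \sum_k \sum_j C e j k k j + \sum_k \sum_j C j k e k j.
  rewrite -!big_split; apply: eq_bigr => k _; rewrite -!big_split.
  by apply: eq_bigr => j _; rewrite [LHS]mxE [X in X + _]mxE.
rewrite big1 => [|k _]; last by rewrite big1// => j _; rewrite bianchi mxE.
rewrite sum3 sum_divergence sum_scalar.
lra.
Qed.
End BianchiTrace.

(** * Curvature of a symmetric connection with a parallel symmetric tensor *)

Section ContractedBianchi.
Variables (R : realType) (m : nat) (U : set 'rV[R]_m).
Hypothesis oU : open U.
Local Notation mxfun := ('rV[R]_m -> 'M[R]_m).
Variables (Gam : 'I_m -> mxfun) (P : mxfun).
Hypothesis sGam : forall k, smooth_mx U (Gam k).
Hypothesis sP : smooth_mx U P.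
Hypothesis Gam_sym : forall x i j l, U x -> Gam i x l j = Gam j x l i.
Hypothesis P_sym : forall x, U x -> (P x)^T = P x.
Hypothesis P_parallel : forall k x, U x ->
  partial_mx k P x = - (Gam k x *m P x + P x *m (Gam k x)^T).

Let addmxE (A B : 'M[R]_m) a b : (A + B) a b = A a b + B a b.
Proof. exact: mxE. Qed.
Let oppmxE (A : 'M[R]_m) a b : (- A) a b = - A a b.
Proof. exact: mxE. Qed.
Let trmxD (A B : 'M[R]_m) : (A + B)^T = A^T + B^T.
Proof. exact: linearD. Qed.
Let trmxN (A : 'M[R]_m) : (- A)^T = - A^T.
Proof. exact: linearN. Qed.

(** The commutator of the operators [partial_i + Gam i] and [partial_j + Gam j]. *)
Definition curvature i j : mxfun := fun x =>
  partial_mx i (Gam j) x - partial_mx j (Gam i) x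
  + (Gam i x *m Gam j x - Gam j x *m Gam i x).

(* [curvature i j] has entries R^a_b ij; this is R^ab_ij. *)
Definition raised_curvature i j : mxfun := fun x => curvature i j x *m P x.

(** The contraction R^li_le, that is, the Ricci tensor with its first index raised. *)
Definition mixed_ricci i e : 'rV[R]_m -> R := fun x =>
  \sum_l raised_curvature l e x l i.

Lemma curvature_entry i j x a b : curvature i j x a b =
  partial i (fun y => Gam j y a b) x - partial j (fun y => Gam i y a b) x
  + (\sum_p Gam i x a p * Gam j x p b - \sum_p Gam j x a p * Gam i x p b).
Proof.
rewrite /curvature addmxE; congr (_ + _).
  by rewrite addmxE oppmxE; congr (_ - _); exact: partial_mxE.
by rewrite addmxE oppmxE; congr (_ - _); exact: mxE.
Qed.

Lemma smooth_curvature i j : smooth_mx U (curvature i j).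
Proof.
apply: smooth_mx_add => //.
  apply: smooth_mx_add => //; first exact: smooth_partial_mx.
  by apply: smooth_mx_opp => //; exact: smooth_partial_mx.
apply: smooth_mx_add => //; first exact: smooth_mx_mul.
by apply: smooth_mx_opp => //; exact: smooth_mx_mul.
Qed.

Lemma smooth_raised_curvature i j : smooth_mx U (raised_curvature i j).
Proof. by apply: smooth_mx_mul => //; exact: smooth_curvature. Qed.

Lemma raised_curvatureC i j x : raised_curvature j i x = - raised_curvature i j x.
Proof.
rewrite /raised_curvature -mulNmx; congr (_ *m _); rewrite /curvature.
by rewrite opprD !opprB.
Qed.

(** [P_parallel] is differentiated and then substituted into itself, so that exchanging [i] and [j]
    compares expressions without second derivatives of [P]. *)
Lemma partial2_inverse_metric i j x : U x ->
  partial_mx i (partial_mx j P) x =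
  - ((partial_mx i (Gam j) x *m P x
      - Gam j x *m (Gam i x *m P x + P x *m (Gam i x)^T))
     + (- (Gam i x *m P x + P x *m (Gam i x)^T) *m (Gam j x)^T
        + P x *m (partial_mx i (Gam j) x)^T)).
Proof.
move=> Ux.
have s1 : smooth_mx U (fun y => Gam j y *m P y) by exact: smooth_mx_mul.
have sT : smooth_mx U (fun y => (Gam j y)^T) by exact: smooth_mx_tr.
have s2 : smooth_mx U (fun y => P y *m (Gam j y)^T) by exact: smooth_mx_mul.
have E : {in U, partial_mx j P =1 fun y => - (Gam j y *m P y + P y *m (Gam j y)^T)}.
  by move=> y; rewrite inE => Uy; rewrite P_parallel.
have Ui : x \in U by rewrite inE.
apply: etrans (partial_mx_ext oU i E Ui) _.
rewrite (partial_mx_opp i (smooth_mx_add oU s1 s2) Ux) (partial_mx_add i s1 s2 Ux).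
rewrite (partial_mx_mul i (sGam j) sP Ux) (partial_mx_mul i sP sT Ux).
by rewrite partial_mx_tr !P_parallel// mulmxN.
Qed.

Let skew_of_commuting (Dij Dji Gi Gj Q : 'M[R]_m) : Q^T = Q ->
  - ((Dij *m Q - Gj *m (Gi *m Q + Q *m Gi^T))
     + (- (Gi *m Q + Q *m Gi^T) *m Gj^T + Q *m Dij^T)) =
  - ((Dji *m Q - Gi *m (Gj *m Q + Q *m Gj^T))
     + (- (Gj *m Q + Q *m Gj^T) *m Gi^T + Q *m Dji^T)) ->
  ((Dij - Dji + (Gi *m Gj - Gj *m Gi)) *m Q)^T =
  - ((Dij - Dji + (Gi *m Gj - Gj *m Gi)) *m Q).
Proof.
move=> symQ H; rewrite trmx_mul symQ !(trmxD, trmxN, trmx_mul).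
apply/matrixP => a b; move/matrixP/(_ a b): H.
rewrite !(mulmxDl, mulmxDr, mulmxN, mulNmx, opprD, opprK, mulmxA).
rewrite !(addmxE, oppmxE) => H.
lra.
Qed.

(** The Ricci identity for the parallel tensor [P]: since its second partial derivatives commute,
    curvature times [P] plus its transpose is zero. *)
Lemma raised_curvature_skew i j x : U x ->
  (raised_curvature i j x)^T = - raised_curvature i j x.
Proof.
move=> Ux; apply: skew_of_commuting; first exact: P_sym.
exact: etrans (esym (partial2_inverse_metric i j Ux))
  (etrans (partial_mx_comm oU i j sP Ux) (partial2_inverse_metric j i Ux)).
Qed.

(* Only the two upper indices are differentiated covariantly: by symmetry of
   [Gam], the terms for the form indices cancel in the cyclic sum. *)
Definition cov_curvature k i j : mxfun := fun x =>
  partial_mx k (raised_curvature i j) x + Gam k x *m raised_curvature i j x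
  + raised_curvature i j x *m (Gam k x)^T.

(** As [P] is parallel it can be pulled out on the right. What remains is the derivative of an
    endomorphism, with a commutator, to which the Jacobi identity applies. *)
Lemma cov_curvatureE k i j x : U x -> cov_curvature k i j x =
  (partial_mx k (curvature i j) x + Gam k x *m curvature i j x
   - curvature i j x *m Gam k x) *m P x.
Proof.
move=> Ux; rewrite /cov_curvature.
rewrite (partial_mx_mul k (smooth_curvature i j) sP Ux) P_parallel//.
rewrite /raised_curvature.
move: (curvature i j x) (partial_mx k _ x) (Gam k x) (P x) => C D G Q.
apply/matrixP => a b.
rewrite !(mulmxDl, mulmxDr, mulmxN, mulNmx, opprD, opprK, mulmxA).
rewrite !(addmxE, oppmxE); ring.
Qed.

Lemma partial_curvature k i j x : U x -> partial_mx k (curvature i j) x =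
  partial_mx k (partial_mx i (Gam j)) x - partial_mx k (partial_mx j (Gam i)) x
  + (partial_mx k (Gam i) x *m Gam j x + Gam i x *m partial_mx k (Gam j) x
     - (partial_mx k (Gam j) x *m Gam i x + Gam j x *m partial_mx k (Gam i) x)).
Proof.
move=> Ux.
have s1 := smooth_partial_mx oU i (sGam j).
have s2 := smooth_partial_mx oU j (sGam i).
have s3 := smooth_mx_mul oU (sGam i) (sGam j).
have s4 := smooth_mx_mul oU (sGam j) (sGam i).
have s2' := smooth_mx_opp oU s2; have s4' := smooth_mx_opp oU s4.
apply: etrans (partial_mx_add k (smooth_mx_add oU s1 s2') (smooth_mx_add oU s3 s4') Ux) _.
congr (_ + _).
  by apply: etrans (partial_mx_add k s1 s2' Ux) _; rewrite (partial_mx_opp k s2 Ux).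
apply: etrans (partial_mx_add k s3 s4' Ux) _; rewrite (partial_mx_opp k s4 Ux).
by rewrite (partial_mx_mul k (sGam i) (sGam j) Ux) (partial_mx_mul k (sGam j) (sGam i) Ux).
Qed.

(* Jacobi identity for the operators [partial_i + Gam i] *)
Let jacobi (Gi Gj Gk Dij Dji Djk Dkj Dki Dik DDkij DDijk DDjki : 'M[R]_m) :
  (DDkij - DDjki + (Dki *m Gj + Gi *m Dkj - (Dkj *m Gi + Gj *m Dki))
    + Gk *m (Dij - Dji + (Gi *m Gj - Gj *m Gi))
    - (Dij - Dji + (Gi *m Gj - Gj *m Gi)) *m Gk) +
  (DDijk - DDkij + (Dij *m Gk + Gj *m Dik - (Dik *m Gj + Gk *m Dij))
    + Gi *m (Djk - Dkj + (Gj *m Gk - Gk *m Gj))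
    - (Djk - Dkj + (Gj *m Gk - Gk *m Gj)) *m Gi) +
  (DDjki - DDijk + (Djk *m Gi + Gk *m Dji - (Dji *m Gk + Gi *m Djk))
    + Gj *m (Dki - Dik + (Gk *m Gi - Gi *m Gk))
    - (Dki - Dik + (Gk *m Gi - Gi *m Gk)) *m Gj) = 0.
Proof.
apply/matrixP => a b; rewrite [RHS]mxE.
rewrite !(mulmxDl, mulmxDr, mulmxN, mulNmx, opprD, opprK, mulmxA).
rewrite !(addmxE, oppmxE); ring.
Qed.

Lemma second_bianchi k i j x : U x ->
  cov_curvature k i j x + cov_curvature i j k x + cov_curvature j k i x = 0.
Proof.
move=> Ux; rewrite (cov_curvatureE k i j Ux) (cov_curvatureE i j k Ux).
rewrite (cov_curvatureE j k i Ux) -!mulmxDl.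
rewrite (partial_curvature k i j Ux) (partial_curvature i j k Ux).
rewrite (partial_curvature j k i Ux) /curvature.
rewrite (partial_mx_comm oU k j (sGam i) Ux) (partial_mx_comm oU i k (sGam j) Ux).
rewrite (partial_mx_comm oU j i (sGam k) Ux).
by rewrite jacobi mul0mx.
Qed.

Lemma partial_raised_curvature_skew x : U x -> forall k i j,
  (partial_mx k (raised_curvature i j) x)^T = - partial_mx k (raised_curvature i j) x.
Proof.
move=> Ux k i j.
have E : {in U, (fun y => (raised_curvature i j y)^T) =1
                (fun y => - raised_curvature i j y)}.
  by move=> y; rewrite inE; exact: raised_curvature_skew.
have Ui : x \in U by rewrite inE.
rewrite -partial_mx_tr (partial_mx_ext oU k E Ui).
by rewrite (partial_mx_opp k (smooth_raised_curvature i j) Ux).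
Qed.

Lemma partial_raised_curvatureC x : U x -> forall k i j,
  partial_mx k (raised_curvature j i) x = - partial_mx k (raised_curvature i j) x.
Proof.
move=> Ux k i j.
have E : {in U, raised_curvature j i =1 (fun y => - raised_curvature i j y)}.
  by move=> y _; exact: raised_curvatureC.
have Ui : x \in U by rewrite inE.
rewrite (partial_mx_ext oU k E Ui).
by rewrite (partial_mx_opp k (smooth_raised_curvature i j) Ux).
Qed.

Lemma partial_mixed_ricci k i e x : U x -> partial k (mixed_ricci i e) x =
  \sum_l partial_mx k (raised_curvature l e) x l i.
Proof.
move=> Ux; rewrite /mixed_ricci partial_sum.
  by apply: eq_bigr => l _; rewrite partial_mxE.
by move=> l; exact: smooth_mx_differentiable (smooth_raised_curvature l e) Ux.
Qed.

Lemma contracted_bianchi e x : U x ->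
  2 * (\sum_k partial k (mixed_ricci k e) x
       + \sum_k \sum_p Gam k x k p * mixed_ricci p e x
       - \sum_k \sum_p Gam e x k p * mixed_ricci p k x) =
  \sum_i partial e (mixed_ricci i i) x.
Proof.
move=> Ux.
have -> : \sum_k partial k (mixed_ricci k e) x =
    \sum_k \sum_l partial_mx k (raised_curvature l e) x l k.
  by apply: eq_bigr => k _; exact: partial_mixed_ricci.
apply: etrans; last first.
  by apply: eq_bigr => i _; apply/esym; exact: partial_mixed_ricci.
apply: (@bianchi_trace R m (fun i j => raised_curvature i j x)
  (fun k i j => partial_mx k (raised_curvature i j) x) (fun k => Gam k x)).
- by move=> i j; exact: raised_curvatureC.
- by move=> i j; exact: raised_curvature_skew.
- exact: partial_raised_curvatureC Ux.
- exact: partial_raised_curvature_skew Ux.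
- by move=> i j l; exact: Gam_sym.
- by move=> k i j; exact: second_bianchi.
Qed.
End ContractedBianchi.

(** * The Levi-Civita connection in coordinates *)

Section MetricBianchi.
Variables (R : realType) (m : nat) (U : set 'rV[R]_m).
Variable G : 'rV[R]_m -> 'M[R]_m.
Hypothesis oU : open U.
Hypothesis sG : smooth_mx U G.
Hypothesis G_sym : forall x, U x -> (G x)^T = G x.
Hypothesis G_unit : forall x, U x -> G x \in unitmx.

Definition inverse_metric x := invmx (G x).

Definition connection k x : 'M[R]_m := \matrix_(l, j) christoffel G l k j x.

Lemma connectionE k x l j : connection k x l j = christoffel G l k j x.
Proof. exact: mxE. Qed.

Lemma smooth_inverse_metric : smooth_mx U inverse_metric.
Proof. exact: smooth_mx_invmx. Qed.

Lemma metric_entry_sym i j x : U x -> G x i j = G x j i.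
Proof. by move=> Ux; rewrite -{1}(G_sym Ux) mxE. Qed.

Lemma partial_metric_sym k i j x : U x ->
  partial k (fun y => G y i j) x = partial k (fun y => G y j i) x.
Proof.
move=> Ux; apply: (eq_on_partial oU); last by rewrite inE.
by move=> y; rewrite inE; exact: metric_entry_sym.
Qed.

Lemma inverse_metric_sym x : U x -> (inverse_metric x)^T = inverse_metric x.
Proof. by move=> Ux; rewrite /inverse_metric trmx_inv G_sym. Qed.

Lemma smooth_connection k : smooth_mx U (connection k).
Proof.
move=> l j; apply: (@smooth_ext _ _ _ oU (christoffel G l k j)).
  by move=> x _; rewrite connectionE.
apply: smooth_mul; [by []|exact: smooth_const|].
apply: smooth_sum => // p _; apply: smooth_mul => //; first exact: smooth_inverse_metric.
apply: smooth_add => //.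
  by apply: smooth_add => //; apply: smooth_partial; exact: sG.
by apply: smooth_opp => //; apply: smooth_partial; exact: sG.
Qed.

Lemma connection_sym x i j l : U x -> connection i x l j = connection j x l i.
Proof.
move=> Ux; rewrite !connectionE /christoffel; congr (_ * _).
apply: eq_bigr => p _; congr (_ * (_ - _)); last exact: partial_metric_sym.
exact: addrC.
Qed.

Lemma lower_connection k x a j : U x -> (G x *m connection k x) a j =
  2^-1 * (partial k (fun y => G y j a) x + partial j (fun y => G y k a) x
          - partial a (fun y => G y k j) x).
Proof.
move=> Ux; pose c : 'cV[R]_m := \col_p
  (partial k (fun y => G y j p) x + partial j (fun y => G y k p) x
          - partial p (fun y => G y k j) x).
have E : col j (connection k x) = 2^-1 *: (invmx (G x) *m c).
  apply/matrixP => l b; rewrite [LHS]mxE connectionE [RHS]mxE; congr (_ * _).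
  by rewrite [RHS]mxE; apply: eq_bigr => p _; rewrite [c p b]mxE.
have -> : (G x *m connection k x) a j = (G x *m col j (connection k x)) a 0.
  by rewrite colE mulmxA -colE [RHS]mxE.
by rewrite E -scalemxAr mulKVmx ?G_unit// !mxE.
Qed.

(** Metric compatibility: when the lowered Christoffel symbols are added to their transpose, the
    derivatives in the directions [a] and [j] cancel. *)
Lemma partial_metric k x : U x -> partial_mx k G x =
  G x *m connection k x + (G x *m connection k x)^T.
Proof.
move=> Ux; apply/matrixP => a j.
rewrite [RHS]mxE [X in _ = _ + X]mxE !lower_connection// partial_mxE.
rewrite (partial_metric_sym k j a Ux) (partial_metric_sym j k a Ux).
rewrite (partial_metric_sym a k j Ux).
move: (partial _ _ _) (partial _ _ _) (partial _ _ _) => p q r; lra.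
Qed.

Lemma partial_inverse_metric k x : U x -> partial_mx k inverse_metric x =
  - (inverse_metric x *m partial_mx k G x *m inverse_metric x).
Proof.
move=> Ux; have uG := G_unit Ux.
have E : {in U, (fun y => G y *m inverse_metric y) =1 (fun=> 1%:M)}.
  by move=> y; rewrite inE => Uy; rewrite mulmxV// G_unit.
have Ui : x \in U by rewrite inE.
have D0 : partial_mx k (fun=> 1%:M : 'M[R]_m) x = 0.
  by apply/matrixP => a b; rewrite partial_mxE partial_const mxE.
have := partial_mx_ext oU k E Ui.
rewrite D0 (partial_mx_mul k sG smooth_inverse_metric Ux).
move/(congr1 (mulmx (inverse_metric x))).
rewrite mulmx0 mulmxDr !mulmxA [X in _ + X *m _ = _]mulVmx// mul1mx.
by move=> /eqP; rewrite addrC addr_eq0 => /eqP.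
Qed.

Lemma inverse_metric_parallel k x : U x -> partial_mx k inverse_metric x =
  - (connection k x *m inverse_metric x
     + inverse_metric x *m (connection k x)^T).
Proof.
move=> Ux; rewrite partial_inverse_metric// partial_metric// trmx_mul G_sym//.
rewrite mulmxDr mulmxDl !mulmxA [X in X *m _ *m _]mulVmx ?G_unit// mul1mx.
by rewrite -(mulmxA _ (G x)) [X in _ + _ *m X]mulmxV ?G_unit// mulmx1.
Qed.

(** The two sides order the lower Christoffel indices differently. Their symmetry is needed on all
    of [U], since it is used under derivatives. *)
Lemma ricciE i j x : U x ->
  ricci G i j x = \sum_l curvature connection l j x l i.
Proof.
move=> Ux; apply: eq_bigr => l _.
rewrite curvature_entry -sumrB.
have -> : (fun y => connection l y l i) = christoffel G l l i.
  by apply/funext => y; rewrite connectionE.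
have -> : partial l (fun y => connection j y l i) x = partial l (christoffel G l i j) x.
  apply: (eq_on_partial oU); last by rewrite inE.
  by move=> y; rewrite inE => Uy; rewrite connection_sym// connectionE.
have -> : partial j (christoffel G l l i) x = partial j (christoffel G l i l) x.
  apply: (eq_on_partial oU); last by rewrite inE.
  by move=> y; rewrite inE => Uy; rewrite -!connectionE connection_sym.
congr (_ + _); apply: eq_bigr => p _; rewrite -!connectionE.
by rewrite (connection_sym i j p Ux) (connection_sym i l p Ux).
Qed.

Lemma mixed_ricciE i e x : U x -> mixed_ricci connection inverse_metric i e x =
  \sum_p inverse_metric x i p * ricci G p e x.
Proof.
move=> Ux; rewrite /mixed_ricci.
under [RHS]eq_bigr do rewrite ricciE// mulr_sumr.
rewrite exchange_big; apply: eq_bigr => l _ /=.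
rewrite [LHS]mxE; apply: eq_bigr => p _.
rewrite mulrC; congr (_ * _).
by rewrite -{1}inverse_metric_sym// mxE.
Qed.

(** [T] is kept general so that the mixed Ricci tensor can be given by another formula on [U],
    namely the one that the soliton equation supplies. *)
Lemma contracted_bianchi_metric (T : 'I_m -> 'I_m -> 'rV[R]_m -> R) e x :
  (forall i j y, U y ->
     T i j y = \sum_p inverse_metric y i p * ricci G p j y) ->
  U x ->
  2 * (\sum_k partial k (T k e) x
       + \sum_k \sum_p christoffel G k k p x * T p e x
       - \sum_k \sum_p christoffel G k e p x * T p k x) =
  \sum_i partial e (T i i) x.
Proof.
move=> hT Ux; pose M := mixed_ricci connection inverse_metric.
have TM i j : {in U, T i j =1 M i j}.
  by move=> y; rewrite inE => Uy; rewrite hT// /M mixed_ricciE.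
have Ui : x \in U by rewrite inE.
have pT k i j : partial k (T i j) x = partial k (M i j) x.
  exact: eq_on_partial (TM i j) _ Ui.
have bianchi := contracted_bianchi oU smooth_connection smooth_inverse_metric
  connection_sym inverse_metric_sym inverse_metric_parallel e Ux.
apply: etrans (etrans bianchi _).
  congr (2 * (_ + _ - _)).
  - by apply: eq_bigr => k _; exact: pT.
  - by apply: eq_bigr => k _; apply: eq_bigr => p _; rewrite connectionE TM.
  - by apply: eq_bigr => k _; apply: eq_bigr => p _; rewrite connectionE TM.
by apply: eq_bigr => i _; apply/esym; exact: pT.
Qed.
End MetricBianchi.

(** * The soliton equation in a geodesic coordinate *)

Section GeodesicCoordinate.
Variables (R : realType) (n : nat) (U : set 'rV[R]_n.+1).
Variables (G : 'rV[R]_n.+1 -> 'M[R]_n.+1) (w : 'rV[R]_n.+1 -> R) (eps : R).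
Hypothesis oU : open U.
Hypothesis sG : smooth_mx U G.
Hypothesis G_sym : forall x, U x -> (G x)^T = G x.
Hypothesis G_pos : forall x, U x ->
  forall v : 'rV[R]_n.+1, v != 0 -> 0 < (v *m G x *m v^T) 0 0.
Hypothesis G_row0 : forall x j, U x -> G x 0 j = (j == 0)%:R.
Hypothesis sw : smooth_on U w.
Hypothesis w_radial : forall x j, U x -> j != 0 -> partial j w x = 0.
Hypothesis soliton : forall x i j, U x ->
  ricci G i j x + hessian G w i j x + eps / 2 * G x i j = 0.

Let P := inverse_metric G.

Let G_unit x : U x -> G x \in unitmx.
Proof. by move=> Ux; apply: posdef_unitmx; [exact: G_sym|exact: G_pos]. Qed.

Let scalemxE (a : R) (A : 'M[R]_n.+1) i j : (a *: A) i j = a * A i j.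
Proof. exact: mxE. Qed.

(** A matrix of size [n + 1] whose row and column 0 vanish and whose remaining block is the shape
    operator of the slices; traces of its powers are therefore those of [L]. *)
Definition shape x : 'M[R]_n.+1 :=
  inverse_metric G x *m (2^-1 *: partial_mx 0 G x).

Definition mean x : R := \tr (shape x).

Definition shape_sqr x : R := \tr (shape x *m shape x).

Let sP : smooth_mx U P. Proof. exact: smooth_inverse_metric. Qed.

Lemma smooth_shape : smooth_mx U shape.
Proof.
apply: smooth_mx_mul => // a b.
apply: (@smooth_ext _ _ _ oU (fun y => 2^-1 * partial 0 (fun y => G y a b) y)).
  by move=> x _; rewrite [RHS]mxE partial_mxE.
by apply: smooth_mul => //; [exact: smooth_const|exact: smooth_partial].
Qed.

Lemma partial_metric_row0 k j x : U x -> partial k (fun y => G y 0 j) x = 0.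
Proof.
move=> Ux; apply: etrans (partial_const k ((j == 0)%:R) x).
apply: (eq_on_partial oU); last by rewrite inE.
by move=> y; rewrite inE => Uy; rewrite G_row0.
Qed.

Lemma partial_metric_col0 k j x : U x -> partial k (fun y => G y j 0) x = 0.
Proof.
by move=> Ux; apply: etrans (partial_metric_sym oU G_sym k j 0 Ux) _;
  exact: partial_metric_row0.
Qed.

Lemma inverse_metric_row0 x j : U x -> P x 0 j = (j == 0)%:R.
Proof.
move=> Ux; have e0G : delta_mx 0 0 *m G x = delta_mx 0 0 :> 'rV_n.+1.
  apply/rowP => i; rewrite -rowE !mxE G_row0//.
have e0P : delta_mx 0 0 *m P x = delta_mx 0 0 :> 'rV_n.+1.
  by rewrite -{1}e0G -mulmxA mulmxV ?mulmx1// G_unit.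
by have /rowP/(_ j) := e0P; rewrite -rowE !mxE.
Qed.

Lemma inverse_metric_col0 x j : U x -> P x j 0 = (j == 0)%:R.
Proof.
move=> Ux; rewrite -(inverse_metric_row0 j Ux).
by rewrite /P -{1}(inverse_metric_sym G_sym Ux) mxE.
Qed.

Lemma christoffel_0 l j x : U x -> christoffel G l 0 j x = shape x l j.
Proof.
move=> Ux; rewrite /christoffel /shape [RHS]mxE mulr_sumr.
apply: eq_bigr => p _; rewrite (partial_metric_row0 j p Ux).
rewrite (partial_metric_row0 p j Ux) addr0 subr0.
rewrite (partial_metric_sym oU G_sym 0 j p Ux).
by rewrite scalemxE partial_mxE mulrCA.
Qed.

Lemma shape_row0 x j : U x -> shape x 0 j = 0.
Proof.
move=> Ux; rewrite /shape mxE (bigD1 0)//= big1 => [|p p0].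
  by rewrite mxE partial_mxE partial_metric_row0// !mulr0 addr0.
by rewrite inverse_metric_row0// (negbTE p0) mul0r.
Qed.

Lemma shape_col0 x i : U x -> shape x i 0 = 0.
Proof.
move=> Ux; rewrite /shape mxE big1// => p _.
by rewrite mxE partial_mxE partial_metric_col0// !mulr0.
Qed.

Lemma christoffel_up0 i j x : U x ->
  christoffel G 0 i j x = - (2^-1 * partial 0 (fun y => G y i j) x).
Proof.
move=> Ux; rewrite /christoffel -mulrN; congr (_ * _).
rewrite (bigD1 0)//= big1 => [|p p0]; last first.
  by rewrite inverse_metric_row0// (negbTE p0) mul0r.
rewrite inverse_metric_row0// eqxx mul1r addr0.
by rewrite !partial_metric_col0// addr0 sub0r.
Qed.

Lemma partial2_radial i j x : U x -> (i != 0) || (j != 0) ->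
  partial i (partial j w) x = 0.
Proof.
move=> Ux; have Ui : x \in U by rewrite inE.
have zero k l : l != 0 -> partial k (partial l w) x = 0.
  move=> l0; apply: etrans (partial_const k 0 x).
  apply: (eq_on_partial oU) => // y; rewrite inE => Uy; exact: w_radial.
case/orP; last exact: zero.
(* Commuting the derivatives makes the vanishing derivative in direction [i] the inner one. *)
move=> i0; apply: etrans (partial_comm i j oU sw Ux) _; exact: zero.
Qed.

(** For radial [w] only the symbols with upper index 0 enter, and these are minus the second
    fundamental form of the slices. *)
Lemma hessian_radial i j x : U x -> hessian G w i j x =
  ((i == 0) && (j == 0))%:R * partial 0 (partial 0 w) x
  + partial 0 w x * (2^-1 * partial 0 (fun y => G y i j) x).
Proof.
move=> Ux; rewrite /hessian (bigD1 0)//= big1 => [|l l0]; last first.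
  by rewrite w_radial// mulr0.
rewrite christoffel_up0// addr0 mulNr opprK [X in _ + X]mulrC; congr (_ + _).
have [/andP[/eqP -> /eqP ->]|] := boolP ((i == 0) && (j == 0)); first by rewrite mul1r.
by rewrite negb_and mul0r; exact: partial2_radial.
Qed.

Let T (i j : 'I_n.+1) (y : 'rV[R]_n.+1) : R :=
  - (((i == 0) && (j == 0))%:R * partial 0 (partial 0 w) y)
  - partial 0 w y * shape y i j - eps / 2 * (i == j)%:R.

Let T_ricci i j y : U y -> T i j y = \sum_(p < n.+1) P y i p * ricci G p j y.
Proof.
move=> Uy.
have E p : ricci G p j y = - (((p == 0) && (j == 0))%:R * partial 0 (partial 0 w) y)
  - partial 0 w y * (2^-1 *: partial_mx 0 G y) p j - eps / 2 * G y p j.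
  have := soliton p j Uy; rewrite hessian_radial// scalemxE partial_mxE.
  by lra.
under eq_bigr do rewrite E !mulrBr mulrN.
rewrite !sumrB sumrN; congr (- _ - _ - _).
- rewrite (bigD1 0)//= big1 => [|p p0]; last by rewrite (negbTE p0) mul0r mulr0.
  by rewrite inverse_metric_col0// addr0; case: (i == 0); rewrite ?mul1r ?mul0r.
- rewrite /shape mxE mulr_sumr; apply: eq_bigr => p _; exact: mulrCA.
- have /matrixP/(_ i j) : P y *m G y = 1%:M by rewrite mulVmx// G_unit.
  rewrite !mxE => <-; rewrite mulr_sumr; apply: eq_bigr => p _; exact: mulrCA.
Qed.

Let smooth_w1 : smooth_on U (partial 0 w). Proof. exact: smooth_partial. Qed.
Let smooth_w2 : smooth_on U (partial 0 (partial 0 w)).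
Proof. exact: smooth_partial. Qed.

Lemma partial_mean x : U x ->
  partial 0 mean x = \sum_(i < n.+1) partial 0 (fun y => shape y i i) x.
Proof.
by move=> Ux; rewrite partial_sum// => j; exact: smooth_mx_differentiable smooth_shape Ux.
Qed.

(** The component [Ric(d/dt, d/dt)] is computed twice: from the Christoffel symbols it is
    [- H' - N], from the soliton equation [- w'' - eps / 2]. *)
Lemma mean_evolution x : U x ->
  partial 0 mean x = partial 0 (partial 0 w) x + eps / 2 - shape_sqr x.
Proof.
move=> Ux; have Ui : x \in U by rewrite inE.
have R0 : ricci G 0 0 x = - partial 0 (partial 0 w) x - eps / 2.
  have := soliton 0 0 Ux; rewrite hessian_radial// G_row0// !eqxx partial_metric_row0// mul1r !mulr1 mulr0.
  by lra.
have R1 : ricci G 0 0 x = - partial 0 mean x - shape_sqr x.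
  rewrite partial_mean// /shape_sqr /mxtrace -!sumrN -big_split /=.
  apply: eq_bigr => l _.
  have -> : partial l (christoffel G l 0 0) x = 0.
    apply: etrans (partial_const l 0 x); apply: (eq_on_partial oU) => // y.
    by rewrite inE => Uy; rewrite christoffel_0// shape_col0.
  have -> : partial 0 (christoffel G l 0 l) x = partial 0 (fun y => shape y l l) x.
    apply: (eq_on_partial oU) => // y.
    by rewrite inE => Uy; rewrite christoffel_0.
  rewrite sub0r [(shape x *m _) l l]mxE -sumrN; congr (_ + _); apply: eq_bigr => p _.
  by rewrite !christoffel_0// (shape_col0 p Ux) mulr0 sub0r.
by have := etrans (esym R0) R1; lra.
Qed.

(** In the component 0 of the Bianchi identity, the terms [eps / 2] times the mean curvature cancel
    on the divergence side. The derivative of the mean curvature on the trace side is eliminated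
    with [mean_evolution]. *)
Lemma potential_evolution x : U x ->
  partial 0 (partial 0 (partial 0 w)) x =
  (shape_sqr x + eps / 2) * partial 0 w x
  - (mean x - partial 0 w x) * partial 0 (partial 0 w) x.
Proof.
move=> Ux; have Ui : x \in U by rewrite inE.
(* [T] is the mixed Ricci tensor, read off from the soliton equation. *)
have := contracted_bianchi_metric oU sG G_sym G_unit 0 T_ricci Ux.
have dw1 := smooth_differentiable smooth_w1 Ux.
have dw2 := smooth_differentiable smooth_w2 Ux.
have T0 k y : U y -> T k 0 y =
    - ((k == 0)%:R * partial 0 (partial 0 w) y) - eps / 2 * (k == 0)%:R.
  move=> Uy; rewrite /T shape_col0// eqxx andbT; ring.
have -> : \sum_(k < n.+1) partial k (T k 0) x = - partial 0 (partial 0 (partial 0 w)) x.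
  rewrite (bigD1 0)//= big1 => [|k k0]; last first.
    apply: etrans (partial_const k 0 x); apply: (eq_on_partial oU) => // y.
    by rewrite inE => Uy; rewrite T0// (negbTE k0) mul0r mulr0 oppr0 addr0.
  rewrite addr0.
  have E : {in U, T 0 0 =1 fun y => - partial 0 (partial 0 w) y + (- (eps / 2))}.
    by move=> y; rewrite inE => Uy; rewrite T0// eqxx mul1r mulr1.
  apply: etrans (eq_on_partial oU _ E Ui) _.
  rewrite partial_add; [|exact: differentiableN|exact: differentiable_cst].
  by rewrite partial_const addr0 partial_opp.
have -> : \sum_(k < n.+1) \sum_(p < n.+1) christoffel G k k p x * T p 0 x =
    - (mean x * (partial 0 (partial 0 w) x + eps / 2)).
  rewrite /mean /mxtrace mulr_suml -sumrN; apply: eq_bigr => k _.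
  rewrite (bigD1 0)//= big1 => [|p p0]; last first.
    by rewrite T0// (negbTE p0) mul0r mulr0 oppr0 addr0 mulr0.
  rewrite T0// eqxx -!connectionE (connection_sym oU G_sym k 0 k Ux).
  rewrite connectionE christoffel_0// mul1r mulr1 addr0.
  by rewrite -opprD mulrN.
have -> : \sum_(k < n.+1) \sum_(p < n.+1) christoffel G k 0 p x * T p k x =
    - (partial 0 w x * shape_sqr x) - eps / 2 * mean x.
  rewrite /mean /shape_sqr /mxtrace !mulr_sumr -!sumrN -big_split /=.
  apply: eq_bigr => k _; rewrite [(shape x *m _) k k]mxE mulr_sumr -sumrN.
  have -> : - (eps / 2 * shape x k k) =
      \sum_(p < n.+1) - (eps / 2 * (shape x k p * (p == k)%:R)).
    rewrite (bigD1 k)//= big1 => [|p pk]; first by rewrite eqxx mulr1 addr0.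
    by rewrite (negbTE pk) !mulr0 oppr0.
  rewrite -big_split /=; apply: eq_bigr => p _.
  rewrite christoffel_0// /T.
  have -> : shape x k p * (- (((p == 0) && (k == 0))%:R * partial 0 (partial 0 w) x)
     - partial 0 w x * shape x p k - eps / 2 * (p == k)%:R) =
     shape x k p * - (((p == 0) && (k == 0))%:R * partial 0 (partial 0 w) x)
     + (- (partial 0 w x * (shape x k p * shape x p k))
        + - (eps / 2 * (shape x k p * (p == k)%:R))) by ring.
  have [/andP[/eqP -> _]|_] := boolP ((p == 0) && (k == 0)).
    by rewrite shape_col0// mul0r add0r.
  by rewrite mul0r oppr0 mulr0 add0r.
have -> : \sum_(i < n.+1) partial 0 (T i i) x = - partial 0 (partial 0 (partial 0 w)) x
    - (partial 0 (partial 0 w) x * mean x + partial 0 w x * partial 0 mean x).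
  have dm : differentiable mean x.
    by apply: (smooth_differentiable (U := U)) => //; apply: smooth_sum => // i _;
      exact: smooth_shape.
  have dS i j := smooth_mx_differentiable i j smooth_shape Ux.
  have E i : partial 0 (T i i) x =
      - ((i == 0)%:R * partial 0 (partial 0 (partial 0 w)) x)
      + - (partial 0 (partial 0 w) x * shape x i i
           + partial 0 w x * partial 0 (fun y => shape y i i) x).
    rewrite /T eqxx andbb partial_add; last 2 first.
    - apply: differentiable_add.
        by apply: differentiableN; exact: differentiable_mul.
      by apply: differentiableN; exact: differentiable_mul.
    - exact: differentiable_cst.
    rewrite partial_const addr0 partial_add; last 2 first.
    - by apply: differentiableN; exact: differentiable_mul.
    - by apply: differentiableN; exact: differentiable_mul.
    rewrite !partial_opp ?partial_mul ?partial_const ?mul0r ?add0r//.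
    - exact: differentiable_mul.
    - exact: differentiable_mul.
  rewrite (eq_bigr _ (fun i _ => E i)) big_split /= !sumrN big_split /=.
  rewrite -!mulr_sumr -partial_mean//; congr (- _ - _).
  by rewrite -mulr_suml (bigD1 0)//= big1 => [|i /negbTE ->//]; rewrite addr0 mul1r.
rewrite mean_evolution//.
move: (partial 0 (partial 0 (partial 0 w)) x) (partial 0 (partial 0 w) x)
  (partial 0 w x) (mean x) (shape_sqr x) => p3 p2 p1 h N; lra.
Qed.

(** The constant is [n] and not [n + 1] because the trace part is removed with [1 - E], the
    projection onto the slice directions, whose trace is [n]. *)
Lemma mean_sqr_le x : (0 < n)%N -> U x -> mean x ^+ 2 <= n%:R * shape_sqr x.
Proof.
move=> n0 Ux; have nR0 : (0 : R) < n%:R by rewrite ltr0n.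
pose E : 'M[R]_n.+1 := delta_mx 0 0; set h := mean x.
have PE : P x *m E = E.
  apply/matrixP => i j; rewrite !mxE (bigD1 0)//= big1 => [|p p0].
    by rewrite !mxE inverse_metric_col0// addr0; case: (i == 0); rewrite ?mul1r ?mul0r.
  by rewrite mxE (negbTE p0) mulr0.
have PG : P x *m G x = 1%:M by rewrite mulVmx// G_unit.
(* [P *m K] is the trace-free part of the shape operator of the slices. *)
pose K := 2^-1 *: partial_mx 0 G x - (h / n%:R) *: (G x - E).
have K_sym : K^T = K.
  apply/matrixP => i j; rewrite !mxE.
  rewrite (partial_metric_sym oU G_sym 0 j i Ux) (metric_entry_sym G_sym j i Ux).
  by rewrite andbC.
have PK : P x *m K = shape x - (h / n%:R) *: (1%:M - E).
  by rewrite /K mulmxBr; congr (_ - _); rewrite -scalemxAr mulmxBr PG PE.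
have EE : E *m E = E by rewrite mul_delta_mx.
have trE : \tr E = 1.
  rewrite /mxtrace (bigD1 0)//= big1 => [|i i0]; rewrite mxE ?eqxx ?addr0//.
  by rewrite (negbTE i0).
have trSE : \tr (shape x *m E) = 0.
  rewrite mxtrace_mulC /mxtrace big1// => i _; rewrite mxE big1// => p _.
  rewrite mxE; have [/andP[_ /eqP ->]|] := boolP ((i == 0) && (p == 0)).
    by rewrite shape_row0// mulr0.
  by rewrite mul0r.
have := posdef_trace_sqr_ge0 (G_sym Ux) K_sym (G_pos Ux).
rewrite -/(P x) PK mulmxBl !mulmxBr -!scalemxAl -!scalemxAr.
rewrite !mulmxBr !mulmxBl !mulmx1 !mul1mx EE subrr subr0.
have trB (A B : 'M[R]_n.+1) : \tr (A - B) = \tr A - \tr B by exact: linearB.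
rewrite !(trB, mxtraceZ) mxtrace1 trE trSE.
rewrite [\tr (E *m _)]mxtrace_mulC trSE -/(shape_sqr x) -/(mean x) -/h.
set c := h / n%:R => H.
have hc : h = c * n%:R by rewrite /c divfK// gt_eqF.
have n1 : (n.+1)%:R = n%:R + 1 :> R by rewrite -natr1.
move: H; rewrite n1 hc => H.
have : 0 <= n%:R * (shape_sqr x - c * (c * n%:R)) by rewrite mulr_ge0 ?(ltW nR0)//; lra.
lra.
Qed.

End GeodesicCoordinate.

(** * Cohomogeneity one *)

(** The difference quotients vanish identically, so this covers functions not known to be
    differentiable, such as [v] composed with the coordinate 0. *)
Lemma derive_const_along (R : realType) (V : normedModType R) (f : V -> R) (x v : V) :
  (forall h : R, f (h *: v + x) = f x) -> 'D_v f x = 0.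
Proof.
move=> fc; rewrite /derive.
have -> : (fun h => h^-1 *: ((f \o shift x) (h *: v) - f x)) = cst 0.
  by apply/funext => h /=; rewrite fc subrr scaler0.
exact: lim_cst.
Qed.

Section Ray.
Variables (R : realType) (n : nat) (x0 : 'rV[R]_n).

Definition ray (t : R) : 'rV[R]_n.+1 := row_mx (t%:M : 'M[R]_1) x0 : 'rV_(1 + n).

Lemma ray_translate (h t : R) : ray (h + t) = h *: delta_mx 0 0 + ray t.
Proof.
have -> : (delta_mx 0 0 : 'rV[R]_n.+1) = row_mx (1%:M : 'M[R]_1) 0 :> 'rV_(1 + n).
  apply/rowP => j; case: (split_ordP j) => i ->.
    by rewrite row_mxEl ord1 !mxE eqxx.
  by rewrite row_mxEr !mxE.
rewrite /ray [RHS](_ : _ = row_mx (h *: 1%:M + t%:M) (h *: 0 + x0)); last first.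
  by rewrite -add_row_mx -scale_row_mx.
by rewrite scaler0 add0r scalemx1 raddfD.
Qed.

(** The difference quotients coincide as functions of [h], so the derivatives agree whether or not
    the limits exist. *)
Lemma derivable_ray (f : 'rV[R]_n.+1 -> R) (t : R) :
  (derivable (f \o ray) t 1 <-> derivable f (ray t) (delta_mx 0 0)) /\
  'D_1 (f \o ray) t = partial 0 f (ray t).
Proof.
have E : (fun h => h^-1 *: (((f \o ray) \o shift t) (h *: (1 : R)) - (f \o ray) t)) =
    (fun h => h^-1 *: ((f \o shift (ray t)) (h *: delta_mx 0 0) - f (ray t))).
  apply/funext => h; congr (_ *: (f _ - _)) => /=.
  by rewrite [_ *: (1 : R)]mulr1 ray_translate.
by split; rewrite /partial /derivable /derive E.
Qed.

Lemma is_derive_ray (f : 'rV[R]_n.+1 -> R) (t : R) : differentiable f (ray t) ->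
  is_derive t 1 (fun s => f (ray s)) (partial 0 f (ray t)).
Proof.
move=> df; have [h1 h2] := derivable_ray f t.
by split; [apply/h1; exact: diff_derivable|exact: h2].
Qed.

Lemma ray00 t : ray t 0 0 = t.
Proof.
transitivity (ray t 0 (lshift n (0 : 'I_1))).
  by congr (ray t 0 _); exact/val_inj.
by apply: etrans (@row_mxEl R 1 1 n t%:M x0 0 0) _; rewrite mxE eqxx.
Qed.
End Ray.

Lemma exists_pos_lt3 (R : realFieldType) (a b c : R) : 0 < a -> 0 < b -> 0 < c ->
  exists s, [/\ 0 < s, s < a, s < b & s < c].
Proof.
move=> a0 b0 c0; exists (Num.min a (Num.min b c) / 2).
have qa : Num.min a (Num.min b c) <= a by rewrite ge_min lexx.
have qb : Num.min a (Num.min b c) <= b by rewrite !ge_min lexx orbT.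
have qc : Num.min a (Num.min b c) <= c by rewrite !ge_min lexx !orbT.
have q0 : 0 < Num.min a (Num.min b c) by rewrite !lt_min a0 b0.
by move: (Num.min _ _) qa qb qc q0 => q *; split; lra.
Qed.

(** * Even functions on a coordinate line through the special orbit *)

Section EvenFunction.
Variables (R : realType) (m : nat) (W : set 'rV[R]_m) (F : 'rV[R]_m -> R).
Variables (x : 'rV[R]_m) (i : 'I_m) (v : R -> R).
Hypotheses (oW : open W) (sF : smooth_on W F) (Wx : W x).
Let line (r : R) := x + r *: delta_mx 0 i.
Hypothesis F_even : forall r, W (line r) -> F (line r) = v `|r|.

Let line_continuous : {for 0, continuous line}.
Proof.
apply: continuousD; first exact: cst_continuous.
exact: scalel_continuous.
Qed.

Let line0 : line 0 = x. Proof. by rewrite /line scale0r addr0. Qed.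

Let line_in : \forall r \near (0 : R), W (line r).
Proof.
apply: line_continuous; rewrite line0.
exact: open_nbhs_nbhs (conj oW Wx).
Qed.

Let line_dom : exists2 e : R, 0 < e & forall r, `|r| < e -> W (line r).
Proof.
have /nbhs_ballP[e e0 he] := line_in.
by exists e => // r re; apply: he; rewrite -ball_normE /= sub0r normrN.
Qed.

Lemma even_continuous_at0 (d : R) : 0 < d ->
  exists2 s, 0 < s < d & `|v 0 - v s| < d.
Proof.
move=> d0; have [e e0 he] := line_dom.
have cF : {for x, continuous F}.
  exact/differentiable_continuous/(smooth_differentiable sF).
have cl : {for 0, continuous (F \o line)}.
  by apply: continuous_comp => //; rewrite line0.
have /cvgrPdist_lt/(_ _ d0)/nbhs_ballP[e' /= e'0 he'] := cl.
have [s [s0 sd se se']] := exists_pos_lt3 d0 e0 e'0.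
exists s; first by rewrite s0.
have := he' s; rewrite -ball_normE /= sub0r normrN gtr0_norm// => /(_ se').
by rewrite !F_even ?normr0 ?(gtr0_norm s0)//; apply: he; rewrite ?normr0 ?gtr0_norm.
Qed.

Let phi' r := partial i F (line r).

Let is_derive_line_in r : W (line r) -> is_derive r 1 (F \o line) (phi' r).
Proof. exact: (is_derive_coord_line sF). Qed.

(** Near 0 the function [F \o line] is invariant under [r -> - r], so its derivative at 0 is its own
    opposite. *)
Let phi'0 : phi' 0 = 0.
Proof.
have W0 : W (line 0) by rewrite line0.
have d0 := is_derive_line_in W0.
have d1 : is_derive (0 : R) (1 : R) ((F \o line) \o (-%R : R -> R)) (- phi' 0).
  have dN : is_derive (0 : R) (1 : R) (-%R : R -> R) (-1) by exact: is_deriveNid.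
  have dm : is_derive (- 0 : R) (1 : R) (F \o line) (phi' 0) by rewrite oppr0.
  by rewrite -mulrN1; exact: is_derive1_comp.
have d2 : is_derive (0 : R) (1 : R) (F \o line) (- phi' 0).
  apply: near_eq_is_derive d1; have [e e0 he] := line_dom.
  apply/nbhs_ballP; exists e => //= r; rewrite -ball_normE /= sub0r normrN => re.
  by rewrite !F_even ?normrN//; apply: he; rewrite ?normrN.
by move: d0 d2 => [_ e1] [_]; rewrite e1; lra.
Qed.

(** At small [s > 0] the derivative of [v] is that of [F] along the line, which depends continuously
    on [s] and vanishes at 0. *)
Lemma even_derive_at0 (d : R) : 0 < d ->
  exists2 s, 0 < s < d & `|'D_1 v s| < d.
Proof.
move=> d0; have [e e0 he] := line_dom.
have cF : {for x, continuous (partial i F)}.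
  exact/differentiable_continuous/(smooth_differentiable (smooth_partial i sF)).
have cl : {for 0, continuous (partial i F \o line)}.
  by apply: continuous_comp => //; rewrite line0.
have /cvgrPdist_lt/(_ _ d0)/nbhs_ballP[e' /= e'0 he'] := cl.
have [s [s0 sd se se']] := exists_pos_lt3 d0 e0 e'0.
exists s; first by rewrite s0.
have := he' s; rewrite -ball_normE /= sub0r normrN gtr0_norm// => /(_ se').
have Ws : W (line s) by apply: he; rewrite gtr0_norm.
have -> : 'D_1 v s = phi' s.
  have [_ <-] := is_derive_line_in Ws; apply: near_eq_derive.
  (* Within distance [s] of [s] the parameter stays positive, so [|r| = r]; within [e - s] the line
     stays in [W]. *)
  have ss : 0 < Num.min s (e - s) by rewrite lt_min s0 subr_gt0.
  apply/nbhs_ballP; exists (Num.min s (e - s)) => //= r; rewrite -ball_normE /=.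
  rewrite lt_min => /andP[r1 r2].
  have r0 : 0 < r by move: r1; rewrite ltr_norml; lra.
  have re : r < e by move: r2; rewrite distrC ltr_norml; lra.
  by rewrite F_even ?gtr0_norm//; apply: he; rewrite gtr0_norm.
by move: phi'0; rewrite /phi' => ->; rewrite sub0r normrN.
Qed.
End EvenFunction.

(** The block form is available at one point only, so the off-diagonal blocks of the derivative are
    kept; multiplied by the block diagonal inverse, they do not meet the diagonal. *)
Lemma mean_block (R : realType) (n : nat) (Gb : 'rV[R]_n.+1 -> 'M[R]_n.+1)
    (x0 : 'rV[R]_n) (t : R) :
  let g s : 'M[R]_n := drsubmx (Gb (ray x0 s) : 'M[R]_(1 + n)) in
  Gb (ray x0 t) \in unitmx -> Gb (ray x0 t) = block_mx 1%:M 0 0 (g t) :> 'M[R]_(1 + n) ->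
  partial 0 (fun y => Gb y 0 0) (ray x0 t) = 0 ->
  \tr (2^-1 *: (invmx (g t) *m \matrix_(i, j) derive1 (fun s => g s i j) t)) =
  mean Gb (ray x0 t).
Proof.
move=> g uG EG D00; pose D : 'M[R]_(1 + n) := partial_mx 0 Gb (ray x0 t).
have Eg : \matrix_(i, j) derive1 (fun s => g s i j) t = drsubmx D.
  apply/matrixP => i j; rewrite [LHS]mxE derive1E [RHS]mxE [RHS]mxE partial_mxE.
  rewrite -(derivable_ray x0 _ t).2; congr ('D_1 _ t).
  by apply/funext => s; rewrite /g mxE mxE.
have ul0 : ulsubmx D = 0.
  apply/matrixP => i j; rewrite !ord1 mxE mxE partial_mxE mxE -[RHS]D00.
  by congr (partial 0 _ _); apply/funext => y; congr (Gb y _ _); exact/val_inj.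
have ED : D = block_mx 0 (ursubmx D) (dlsubmx D) (drsubmx D).
  by rewrite -[LHS]submxK ul0.
have uB : (block_mx 1%:M 0 0 (g t) : 'M[R]_(1 + n)) \in unitmx by rewrite -EG.
have EP : invmx (Gb (ray x0 t)) = block_mx 1%:M 0 0 (invmx (g t)) :> 'M[R]_(1 + n).
  rewrite EG; apply: etrans (invmx_block_diag uB) _.
  by rewrite invmx1.
transitivity (\tr ((block_mx 1%:M 0 0 (invmx (g t)) : 'M[R]_(1 + n)) *m
    (2^-1 *: block_mx 0 (ursubmx D) (dlsubmx D) (drsubmx D)))).
  rewrite Eg scale_block_mx mulmx_block mxtrace_block.
  by rewrite !mul0mx !addr0 !add0r scaler0 mulmx0 mxtrace0 add0r -scalemxAr.
by rewrite -EP -ED.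
Qed.

(** * The soliton along one ray of a product chart *)

Section CohomogeneityOneSoliton.
Variables (R : realType) (n k : nat) (eps : R) (M P : topologicalType).
Variables (A : set (chart R M n.+1)) (B : set (chart R P n)).
Variables (G : chart R M n.+1 -> 'rV[R]_n.+1 -> 'M[R]_n.+1) (u : M -> R).
Variables (Q : set M) (Phi : R -> P -> M) (proj : M -> P).
Hypothesis hM : smooth_manifold A.
Hypothesis hG : riemannian_metric A G.
Hypothesis hu : smooth_function A u.
Hypothesis hsol : gradient_soliton A G eps u.
Hypothesis hcoh : cohomogeneity_one A B G Q Phi proj k u.
Variable v : R -> R.
Hypothesis uv : forall p, u p = v (dist_to A G Q p).
Variables (c : chart R P n) (p0 : P).
Hypotheses (Bc : B c) (cp0 : cdom c p0).

Let cb := prod_chart A G Q Phi proj c.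
Let x0 := cmap c p0.
Let U := crange cb.
Let w := u \o cinv cb.

Let Acb : A cb. Proof. exact: coh_Phi_diffeo hcoh _ Bc. Qed.

Let oU : open U. Proof. by case: (atlas_chart hM Acb). Qed.

Lemma ray_in (t : R) : 0 < t -> U (ray x0 t).
Proof.
move=> t0; have [nQ dt pt] := coh_Phi hcoh p0 t0.
exists (Phi t p0); first by split; rewrite ?pt.
by rewrite /= dt pt.
Qed.

Lemma prod_range y : U y ->
  exists s x, [/\ 0 < s, crange c x, y = ray x s & w y = v s].
Proof.
move=> [p dp <-]; have [nQ cp] := dp.
have [d0 Pd] := coh_Phi_onto hcoh nQ.
exists (dist_to A G Q p), (cmap c (proj p)); split => //.
  by exists (proj p).
have [_ _ inv _ _] := atlas_chart hM Acb.
by rewrite /w /= -uv; congr u; exact: inv.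
Qed.

Let G_ray_block s x : 0 < s -> crange c x -> G cb (ray x s) =
  block_mx 1%:M 0 0 (slice_metric A G Q Phi proj c s x) :> 'M[R]_(1 + n).
Proof. by move=> s0 cx; exact: coh_metric hcoh _ Bc _ _ s0 cx. Qed.

Let G_row0 y (j : 'I_n.+1) : U y -> G cb y 0 j = (j == 0)%:R.
Proof.
move=> Uy; have [s [x [s0 cx -> _]]] := prod_range Uy.
set S := slice_metric A G Q Phi proj c s x.
have E := G_ray_block s0 cx.
transitivity ((block_mx 1%:M 0 0 S : 'M[R]_(1 + n)) (lshift n 0) (j : 'I_(1 + n))).
  by rewrite -E; congr (G cb _ _ _); exact/val_inj.
case: (split_ordP (j : 'I_(1 + n))) => i ->.
  by rewrite block_mxEul ord1 mxE eqxx; congr (_%:R); apply/esym/eqP/val_inj.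
by rewrite block_mxEur mxE.
Qed.

Let w_coord y : U y -> w y = v (y 0 0).
Proof.
by move=> Uy; have [s [x [s0 _ -> ->]]] := prod_range Uy; rewrite ray00.
Qed.

Let w_radial y (j : 'I_n.+1) : U y -> j != 0 -> partial j w y = 0.
Proof.
move=> Uy j0; have Ui : y \in U by rewrite inE.
have E : {in U, w =1 fun z => v (z 0 0)}.
  by move=> z; rewrite inE; exact: w_coord.
apply: etrans (eq_on_partial oU j E Ui) _; apply: derive_const_along => h.
congr v; rewrite !mxE eq_sym (negbTE j0) andbF mulr0 add0r //.
Qed.

Let sG : smooth_mx U (G cb).
Proof. by move=> i j; exact: metric_smooth hG _ Acb i j. Qed.
Let G_sym y : U y -> (G cb y)^T = G cb y.
Proof. by move=> Uy; exact: (Defs.metric_sym hG Acb Uy). Qed.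
Let G_pos y : U y -> forall z : 'rV[R]_n.+1, z != 0 -> 0 < (z *m G cb y *m z^T) 0 0.
Proof. by move=> Uy; exact: (Defs.metric_pos hG Acb Uy). Qed.
Let sw : smooth_on U w. Proof. exact: hu Acb. Qed.
Let soliton y i j : U y ->
  ricci (G cb) i j y + hessian (G cb) w i j y + eps / 2 * G cb y i j = 0.
Proof. by move=> Uy; exact: hsol. Qed.

Let H t := mean (G cb) (ray x0 t).
Let N t := shape_sqr (G cb) (ray x0 t).
Let w1 t := partial 0 w (ray x0 t).
Let w2 t := partial 0 (partial 0 w) (ray x0 t).

(** As the mean curvature is constant on each slice, an arbitrary chart and point can be exchanged
    for those of the chosen ray. *)
Lemma shape_operator_trace t c' x : 0 < t -> B c' -> crange c' x ->
  \tr (shape_operator A G Q Phi proj c' t x) = H t.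
Proof.
move=> t0 Bc' cx; have [h hh] := coh_mean_curvature hcoh.
have cx0 : crange c x0 by exists p0.
rewrite (hh _ Bc' _ _ t0 cx) -(hh _ Bc _ _ t0 cx0).
have Ut := ray_in t0.
apply: mean_block.
- by apply: posdef_unitmx; [exact: G_sym|exact: G_pos].
- exact: G_ray_block t0 cx0.
- exact: (partial_metric_row0 oU G_row0 0 0 Ut).
Qed.

(** [v] comes with no regularity of its own; it inherits differentiability at positive times from
    [w] along the ray. *)
Lemma is_derive_radial (t : R) : 0 < t -> is_derive t 1 v (w1 t).
Proof.
move=> t0; have dw := is_derive_ray (smooth_differentiable sw (ray_in t0)).
apply: near_eq_is_derive dw.
apply: filterS (open_nbhs_nbhs (conj (@open_gt R 0) t0)) => s s0.
by rewrite (w_coord (ray_in s0)) ray00.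
Qed.

Lemma is_derive_w1 (t : R) : 0 < t -> is_derive t 1 w1 (w2 t).
Proof.
move=> t0; apply: is_derive_ray.
exact: smooth_differentiable (smooth_partial 0 sw) (ray_in t0).
Qed.

Lemma is_derive_w2 (t : R) : 0 < t ->
  is_derive t 1 w2 ((N t + eps / 2) * w1 t - (H t - w1 t) * w2 t).
Proof.
move=> t0; have Ut := ray_in t0.
rewrite /N /H /w1 /w2 -(potential_evolution oU sG G_sym G_pos G_row0 sw w_radial soliton Ut).
apply: is_derive_ray.
exact: smooth_differentiable (smooth_partial 0 (smooth_partial 0 sw)) Ut.
Qed.

Lemma is_derive_mean (t : R) : 0 < t -> is_derive t 1 H (w2 t + eps / 2 - N t).
Proof.
move=> t0; have Ut := ray_in t0.
rewrite /N /w2 -(mean_evolution oU sG G_sym G_pos G_row0 sw w_radial soliton Ut).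
apply: is_derive_ray; apply: smooth_differentiable Ut.
apply: smooth_sum => // i _; exact: (smooth_shape oU sG G_sym G_pos).
Qed.

Let n0 : (0 < n)%N.
Proof. by have /andP[k1 kn] := coh_sphere_dim hcoh; exact: leq_trans k1 kn. Qed.

Lemma mean_sqr_le_ray (t : R) : 0 < t -> H t ^+ 2 <= n%:R * N t.
Proof.
move=> t0; exact (mean_sqr_le oU G_sym G_pos G_row0 n0 (ray_in t0)).
Qed.

(** With [Q] empty, every distance would be the infimum of the empty set, which is 0 by convention,
    whereas [Phi 1 p0] is at distance 1. *)
Lemma special_orbit_nonempty : exists q, Q q.
Proof.
have [//|nQ] := pselect (exists q, Q q).
have [_ d1 _] := coh_Phi hcoh p0 (ltr01 : 0 < 1 :> R).
move: d1; rewrite /dist_to [X in inf X](_ : _ = set0) ?inf0; last first.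
  rewrite -subset0 => l [gamma [_ Qg _ _]].
  by apply: nQ; exists (gamma 0).
by move=> /esym/eqP; rewrite oner_eq0.
Qed.

Let Qcoord c' q : collapse_chart A G Q k c' -> cdom c' q -> Q q ->
  forall i : 'I_n.+1, (n - k <= i)%N -> cmap c' q 0 i = 0.
Proof. by move=> cc cq Qq; have [[h _] _] := cc _ cq; exact: h. Qed.

Lemma dist_orbit q : Q q -> dist_to A G Q q = 0.
Proof.
move=> Qq; have [c' [Ac' cq cc]] := coh_collapse hcoh Qq.
have [_ ->] := cc _ cq; rewrite big1 ?sqrtr0// => i ik.
by rewrite (Qcoord cc)// expr0n.
Qed.

(** The index [ord_max] is among the last [k + 1], so one transversal coordinate is [r] and the
    others vanish. The distance to the orbit is then the square root of [r ^ 2]. *)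
Lemma collapse_line c' q r : A c' -> cdom c' q -> Q q -> collapse_chart A G Q k c' ->
  crange c' (cmap c' q + r *: delta_mx 0 ord_max) ->
  (u \o cinv c') (cmap c' q + r *: delta_mx 0 ord_max) = v `|r|.
Proof.
move=> Ac' cq Qq cc [p cp E].
have [_ _ inv _ _] := atlas_chart hM Ac'.
rewrite /= -E inv// uv; congr v; have [_ ->] := cc _ cp.
rewrite E -sqrtr_sqr; congr (Num.sqrt _).
rewrite (bigD1 ord_max) ?leq_subr//= big1 => [|i /andP[ik im]].
  by rewrite addr0 !mxE !eqxx mulr1 (Qcoord cc) ?leq_subr// add0r.
by rewrite !mxE (negbTE im) andbF mulr0 addr0 (Qcoord cc)// expr0n.
Qed.

Lemma radial_derivative_small (d : R) : 0 < d ->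
  exists2 s : R, 0 < s < d & `|w1 s| < d.
Proof.
move=> d0; have [q Qq] := special_orbit_nonempty.
have [c' [Ac' cq cc]] := coh_collapse hcoh Qq.
have [_ oc' _ _ _] := atlas_chart hM Ac'.
have [||s sd hs] := @even_derive_at0 R n.+1 _ _ (cmap c' q) ord_max v oc' (hu Ac') _ _ d d0.
- by exists q.
- by move=> r; exact: collapse_line.
exists s => //; have [s0 _] := andP sd.
by have [_ <-] := is_derive_radial s0.
Qed.

(** Otherwise [v] is constant at positive times, and continuity of [u] at the orbit makes the
    constant [v 0 = 0]. Then [u] vanishes and the soliton equation becomes the Einstein equation
    with constant [- eps / 2]. *)
Lemma radial_derivative_nonzero : ~ einstein A G -> v 0 = 0 ->
  exists2 t : R, 0 < t & w1 t != 0.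
Proof.
move=> nE v0; apply: contrapT => /forall2NP w10.
have {}w10 t : 0 < t -> w1 t = 0.
  by move=> t0; have [//|/negP] := w10 t; rewrite negbK => /eqP.
have v_const s t : 0 < s -> s < t -> v t = v s.
  move=> s0 st; apply/eqP; rewrite -subr_eq0.
  have [|a /andP[sa _] ->] := @is_derive_mvt R v w1 s t st.
    by move=> a /andP[/(lt_le_trans s0) a0 _]; exact: is_derive_radial.
  by rewrite w10 ?mul0r// (lt_trans s0).
have v1 t : 0 < t -> v t = v 1.
  by move=> t0; have [t1|t1|->//] := ltgtP t 1; [rewrite (v_const t)|rewrite (v_const 1)].
have {}v1 t : 0 < t -> v t = 0.
  move=> t0; rewrite v1//; apply/eqP; rewrite -normr_le0; apply/ler_addgt0Pl => d d0.
  have [q Qq] := special_orbit_nonempty.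
  have [c' [Ac' cq cc]] := coh_collapse hcoh Qq.
  have [_ oc' _ _ _] := atlas_chart hM Ac'.
  have [||s /andP[s0 _]] := @even_continuous_at0 R n.+1 _ _ (cmap c' q) ord_max v oc' (hu Ac') _ _ d d0.
  - by exists q.
  - by move=> r; exact: collapse_line.
  by rewrite v0 sub0r normrN v1// addr0 => /ltW.
have u0 : u = fun=> 0.
  apply/funext => p; rewrite uv; have [Qp|nQ] := pselect (Q p).
    by rewrite dist_orbit.
  by have [d0 _] := coh_Phi_onto hcoh nQ; exact: v1.
apply: nE; exists (- (eps / 2)) => c' Ac' x cx i j.
have := hsol Ac' cx i j.
have -> : hessian (G c') (u \o cinv c') i j x = 0.
  rewrite /hessian u0; have p0' l : partial l ((fun=> 0 : R) \o cinv c') = fun=> 0.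
    by apply/funext => z; exact: partial_const.
  rewrite p0' partial_const sub0r big1 ?oppr0// => l _.
  by rewrite p0' mulr0.
by rewrite addr0 mulNr => /eqP; rewrite addr_eq0 => /eqP.
Qed.

End CohomogeneityOneSoliton.

Theorem proposition1p13 (R : realType) (n k : nat) (eps : R)
  (M P : topologicalType)
  (A : set (chart R M n.+1)) (B : set (chart R P n))
  (G : chart R M n.+1 -> 'rV[R]_n.+1 -> 'M[R]_n.+1) (u : M -> R)
  (Q : set M) (Phi : R -> P -> M) (proj : M -> P)
  (heps : 0 < eps)
  (hM : smooth_manifold A)
  (hG : riemannian_metric A G)
  (hu : smooth_function A u)
  (hsol : gradient_soliton A G eps u)
  (hcomplete : complete_metric A G)
  (hnonEinstein : ~ einstein A G)
  (hcoh : cohomogeneity_one A B G Q Phi proj k u) :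
  exists2 t1 : R, 0 < t1 &
    forall t, t1 < t -> forall c, B c -> forall x, crange c x ->
      \tr (shape_operator A G Q Phi proj c t x) < Num.sqrt (n%:R * eps / 2).
Proof.
have [v v0 uv] := coh_potential hcoh.
have [[c [p0 [Bc cp0]]]|noP] := pselect (exists c p0, B c /\ cdom c p0); last first.
  (* If no chart in [B] contains a point, the conclusion is vacuous and any positive [t1] serves. *)
  by exists 1 => // t _ c Bc x [p cp _]; exfalso; apply: noP; exists c, p.
have /andP[k1 kn] := coh_sphere_dim hcoh.
have [t1 t10 ht1] := ode_mean_curvature_bound heps (leq_trans k1 kn)
  (is_derive_w1 hu hcoh Bc cp0)
  (is_derive_w2 hM hG hu hsol hcoh uv Bc cp0)
  (is_derive_mean hM hG hu hsol hcoh uv Bc cp0)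
  (mean_sqr_le_ray hM hG hcoh uv Bc cp0)
  (radial_derivative_small hM hu hcoh uv Bc cp0)
  (radial_derivative_nonzero hM hu hsol hcoh uv Bc cp0 hnonEinstein v0).
exists t1 => // t tt1 c' Bc' x cx.
rewrite (shape_operator_trace hM hG hcoh uv Bc cp0 (lt_trans t10 tt1) Bc' cx).
exact: ht1.
Qed.
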